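(* Let $d\ge 1$ and let $F=\{A_1,\dots,A_m\}$ be a collection of polyhedra in $\mathbb R^d$ with $m\ge d+2$. Suppose that for every $n$ with $1\le n\le d+1$ and every subfamily $F'\subset F$ of size $n$, $$\tilde H_{d-n}\Big(\bigcap_{A\in F'}A\Big)=0 .$$ Then $\bigcap_{i=1}^m A_i\neq\emptyset$.
   Context: All homology is reduced homology $\tilde H_*$ with coefficients in a fixed field. By convention, $\tilde H_{-1}(A)=0$ means that $A$ is nonempty. In particular, for $n=d+1$ the hypothesis says that every $d+1$ members of $F$ have nonempty intersection. *)

(* Defs.v *)
From HB Require Import structures.
From mathcomp Require Import all_boot all_order all_algebra.
From Stdlib Require Import Reals ClassicalEpsilon.
Set Implicit Arguments. Unset Strict Implicit. Unset Printing Implicit Defensive.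

Definition pt (d : nat) := 'I_d -> R.
Definition rset (d : nat) := pt d -> Prop.

Definition lsumR (s : seq R) : R := foldr Rplus 0%R s.

Definition conv_hull (d : nat) (ps : seq (pt d)) (x : pt d) : Prop :=
  exists lam : seq R,
    size lam = size ps /\ (forall l, List.In l lam -> (0 <= l)%R) /\
    lsumR lam = 1%R /\
    forall j : 'I_d, x j = lsumR [seq (p.1 * p.2 j)%R | p <- zip lam ps].

Definition polyhedron (d : nat) (A : rset d) : Prop :=
  exists Ps : seq (seq (pt d)),
    forall x, A x <-> exists ps, List.In ps Ps /\ conv_hull ps x.

Definition std_simplex (n : nat) (t : nat -> R) : Prop :=
  (forall k, leq k n -> (0 <= t k)%R) /\
  (forall k, ltn n k -> t k = 0%R) /\
  sum_f_R0 t n = 1%R.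

(* Candidate singular n-simplices: maps (only their values on the standard
   simplex matter). *)
Definition smap (d : nat) := (nat -> R) -> pt d.

Definition sing_simplex (d : nat) (A : rset d) (n : nat) (sigma : smap d) : Prop :=
  (forall t, std_simplex n t -> A (sigma t)) /\
  (forall t, std_simplex n t -> forall eps, (0 < eps)%R ->
     exists delta, (0 < delta)%R /\
       forall s, std_simplex n s ->
         (forall k, leq k n -> (Rabs (s k - t k) < delta)%R) ->
         forall j, (Rabs (sigma s j - sigma t j) < eps)%R).

Definition same_simplex (d n : nat) (f g : smap d) : bool :=
  if excluded_middle_informative (forall t, std_simplex n t -> f t = g t)
  then true else false.

Definition chain (K : fieldType) (d : nat) := seq (K * smap d).

Definition chain_in (K : fieldType) (d : nat) (A : rset d) (n : nat)
  (c : chain K d) : Prop :=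
  forall p, List.In p c -> sing_simplex A n p.2.

Local Open Scope ring_scope.

Definition coef (K : fieldType) (d n : nat) (c : chain K d) (sigma : smap d) : K :=
  \sum_(p <- c) (if same_simplex n p.2 sigma then p.1 else 0).

Definition chain_zero (K : fieldType) (d n : nat) (c : chain K d) : Prop :=
  forall sigma, coef n c sigma = 0.

Definition face (i : nat) (t : nat -> R) : nat -> R :=
  fun k => if ltn k i then t k else if k == i then 0%R else t k.-1.

Definition bd (K : fieldType) (d n : nat) (c : chain K d) : chain K d :=
  flatten [seq [seq ((-1) ^+ i * p.1, fun t => p.2 (face i t)) | i <- iota 0 n.+1]
          | p <- c].

Definition chain_sub (K : fieldType) (d : nat) (c b : chain K d) : chain K d :=
  c ++ [seq (- p.1, p.2) | p <- b].

Definition red_cycle (K : fieldType) (d n : nat) (c : chain K d) : Prop :=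
  match n with
  | 0 => \sum_(p <- c) p.1 = 0
  | k.+1 => chain_zero k (bd k.+1 c)
  end.

Definition Hred_zero (K : fieldType) (d : nat) (A : rset d) (q : int) : Prop :=
  match q with
  | Posz n => forall c : chain K d, chain_in A n c -> red_cycle n c ->
      exists b : chain K d, chain_in A n.+1 b /\ chain_zero n (chain_sub c (bd n.+1 b))
  | Negz 0 => exists x, A x      (* \tilde H_{-1}(A) = 0 iff A nonempty *)
  | Negz _ => True
  end.

Definition bigcapS (d m : nat) (A : 'I_m -> rset d) (S : {set 'I_m}) : rset d :=
  fun x => forall i, i \in S -> A i x.

(* Main.v *)
(** Every polyhedron is a closed union of cells of one hyperplane arrangement,
    closed under negation of its affine forms. Strictly decreasing flags of
    cells, mapped affinely to [R^d] through a point of each cell, form a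
    simplicial complex of dimension at most [d], and each [A_i] gives a
    subcomplex. A cycle of flags that bounds
    singularly in a closed union of cells bounds a chain of flags there: iterated
    barycentric subdivision followed by the rounding of points to nearby cells
    (small values of the affine forms are rounded to 0) is a chain map from
    singular chains to flags, chain homotopic to the identity on flags by cones.
    For [R^d] itself this says that a [d]-cycle of flags bounds, hence vanishes,
    so every subcomplex is acyclic in degrees [>= d]. Mayer-Vietoris then
    propagates acyclicity: by induction on [n], all intersections of [n] of the
    sets are acyclic in all degrees [>= max (d - n, -1)]; for [n = m] and
    degree [-1] this is the theorem. *)
Require Import Defs.
From HB Require Import structures.
From mathcomp Require Import all_boot all_order all_algebra.
From Stdlib Require Import Reals ClassicalEpsilon FunctionalExtensionality.
From mathcomp Require Import boolp Rstruct zify ring lra.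
From Coquelicot Require Compactness.
Set Implicit Arguments. Unset Strict Implicit. Unset Printing Implicit Defensive.
Import GRing.Theory Num.Theory Order.TTheory.
Delimit Scope R_scope with coqR.
Delimit Scope nat_scope with N.
Delimit Scope ring_scope with R.
Local Open Scope ring_scope.

(** * Formal chains and Mayer-Vietoris *)

(** Chains are lists without normal form and are used only through their values on cochains, so
    cancellation never has to be computed. A singular chain that is zero is tested on cochains that
    see a simplex only through its values on the standard simplex. Two obstacles shape the
    comparison. The sign patterns of nearby points need not be comparable: near a corner, two forms
    can be positive at one point each. Rounding with point-dependent thresholds repairs this.
    Comparable cells at the vertices of a small simplex still come in no particular order, so one
    more formal subdivision, whose apexes are unions of cells, sorts them into decreasing sequences.
    Repetitions in these are discarded at the very end. *)

Section Chains.
Variable K : fieldType.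

Definition ev (X : Type) (c : seq (K * X)) (phi : X -> K) : K :=
  \sum_(p <- c) p.1 * phi p.2.

Definition supp (X : Type) (Q : X -> Prop) (c : seq (K * X)) : Prop :=
  forall p, List.In p c -> Q p.2.

Lemma ev_cat (X : Type) (c1 c2 : seq (K * X)) phi :
  ev (c1 ++ c2) phi = ev c1 phi + ev c2 phi.
Proof. exact: big_cat. Qed.

Lemma ev_cons (X : Type) p (c : seq (K * X)) phi :
  ev (p :: c) phi = p.1 * phi p.2 + ev c phi.
Proof. exact: big_cons. Qed.

Lemma ev_nil (X : Type) (phi : X -> K) : ev [::] phi = 0.
Proof. exact: big_nil. Qed.

Lemma eq_ev_supp (X : Type) (Q : X -> Prop) (c : seq (K * X)) phi psi :
  supp Q c -> (forall x, Q x -> phi x = psi x) -> ev c phi = ev c psi.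
Proof.
move=> + eqQ; elim: c => [|p c IH] Qc; first by rewrite !ev_nil.
rewrite !ev_cons eqQ ?IH // => [q cq|]; first by apply: Qc; right.
by apply: Qc; left.
Qed.

Lemma eq_ev (X : Type) (c : seq (K * X)) phi psi :
  phi =1 psi -> ev c phi = ev c psi.
Proof. by move=> e; apply: eq_bigr => p _; rewrite e. Qed.

Lemma evD (X : Type) (c : seq (K * X)) phi psi :
  ev c (fun x => phi x + psi x) = ev c phi + ev c psi.
Proof. by rewrite -big_split; apply: eq_bigr => p _; rewrite mulrDr. Qed.

Lemma evN (X : Type) (c : seq (K * X)) phi :
  ev c (fun x => - phi x) = - ev c phi.
Proof. by rewrite -sumrN; apply: eq_bigr => p _; rewrite mulrN. Qed.

Lemma evB (X : Type) (c : seq (K * X)) phi psi :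
  ev c (fun x => phi x - psi x) = ev c phi - ev c psi.
Proof. by rewrite evD evN. Qed.

Lemma evZ (X : Type) (c : seq (K * X)) k phi :
  ev c (fun x => k * phi x) = k * ev c phi.
Proof. by rewrite mulr_sumr; apply: eq_bigr => p _; rewrite mulrCA. Qed.

Lemma ev0 (X : Type) (c : seq (K * X)) : ev c (fun=> 0) = 0.
Proof. by rewrite /ev big1 // => p _; rewrite mulr0. Qed.

Lemma ev_map (X Y : Type) (f : X -> Y) (c : seq (K * X)) phi :
  ev [seq (p.1, f p.2) | p <- c] phi = ev c (fun x => phi (f x)).
Proof. by rewrite /ev big_map. Qed.

(* A functional on cochains has [rep Q] when it is evaluation on a finite chain
   supported in [Q]; chains are handled through such functionals. *)
Definition rep (X : Type) (Q : X -> Prop) (F : (X -> K) -> K) : Prop :=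
  exists c, supp Q c /\ forall phi, F phi = ev c phi.

Lemma rep_ext (X : Type) (Q : X -> Prop) F G : F =1 G -> rep Q F -> rep Q G.
Proof. by move=> e [c [cQ cE]]; exists c; split=> // phi; rewrite -e. Qed.

Lemma rep_impl (X : Type) (Q Q' : X -> Prop) F :
  (forall x, Q x -> Q' x) -> rep Q F -> rep Q' F.
Proof. by move=> QQ' [c [cQ cE]]; exists c; split=> // p /cQ /QQ'. Qed.

Lemma rep_point (X : Type) (Q : X -> Prop) x : Q x -> rep Q (fun phi => phi x).
Proof.
move=> Qx; exists [:: (1, x)]; split=> [p [<-|] // | phi].
by rewrite ev_cons ev_nil addr0 mul1r.
Qed.

Lemma rep0 (X : Type) (Q : X -> Prop) : rep Q (fun=> 0).
Proof. by exists [::]; split=> // phi; rewrite ev_nil. Qed.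

Lemma repD (X : Type) (Q : X -> Prop) F G :
  rep Q F -> rep Q G -> rep Q (fun phi => F phi + G phi).
Proof.
move=> [c [cQ cE]] [b [bQ bE]]; exists (c ++ b); split=> [p|phi]; last first.
  by rewrite ev_cat cE bE.
by move=> /List.in_app_iff [/cQ|/bQ].
Qed.

Lemma repZ (X : Type) (Q : X -> Prop) k F :
  rep Q F -> rep Q (fun phi => k * F phi).
Proof.
move=> [c [cQ cE]]; exists [seq (k * p.1, p.2) | p <- c]; split.
  by move=> p /List.in_map_iff [q [<- /cQ]].
by move=> phi; rewrite cE /ev big_map mulr_sumr; apply: eq_bigr => p _;
   rewrite mulrA.
Qed.

Lemma repN (X : Type) (Q : X -> Prop) F : rep Q F -> rep Q (fun phi => - F phi).
Proof. by move/(repZ (-1)); apply: rep_ext => phi; rewrite mulN1r. Qed.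

Lemma repB (X : Type) (Q : X -> Prop) F G :
  rep Q F -> rep Q G -> rep Q (fun phi => F phi - G phi).
Proof. by move=> rF rG; apply: repD => //; apply: repN. Qed.

(** Linear extension in dual form: a map [G] from simplices to chains is applied to a whole chain
    [F], and the support bound goes with it. *)
Lemma rep_bind (X Y : Type) (Q : X -> Prop) (Q' : Y -> Prop) F G :
  rep Q F -> (forall x, Q x -> rep Q' (G x)) ->
  rep Q' (fun phi => F (fun x => G x phi)).
Proof.
move=> [c [cQ cE]] rG.
apply: (@rep_ext _ _ (fun phi => ev c (fun x => G x phi))) => [phi|].
  by rewrite cE.
elim: c cQ {F cE} => [|p c IH] cQ.
  by apply: (rep_ext _ (@rep0 _ _)) => phi; rewrite ev_nil.
apply: (@rep_ext _ _ (fun phi => p.1 * G p.2 phi + ev c (fun x => G x phi))).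
  by move=> phi; rewrite ev_cons.
apply: repD; last by apply: IH => q cq; apply: cQ; right.
by apply/repZ/rG/cQ; left.
Qed.

Lemma rep_map (X Y : Type) (Q : X -> Prop) (Q' : Y -> Prop) (f : X -> Y) F :
  (forall x, Q x -> Q' (f x)) ->
  rep Q F -> rep Q' (fun phi => F (fun x => phi (f x))).
Proof.
by move=> QQ' rF; apply: (rep_bind (G := fun x phi => phi (f x)) rF) => x /QQ';
   apply: rep_point.
Qed.

Lemma rep_eq_on (X : Type) (Q : X -> Prop) F phi psi :
  rep Q F -> (forall x, Q x -> phi x = psi x) -> F phi = F psi.
Proof. by move=> [c [cQ cE]] e; rewrite !cE; apply: eq_ev_supp e. Qed.

Lemma rep_lin (X : Type) (Q : X -> Prop) F phi psi : rep Q F ->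
  F (fun x => phi x - psi x) = F phi - F psi.
Proof. by move=> [c [cQ cE]]; rewrite !cE evB. Qed.

Lemma rep_eq0 (X : Type) (Q : X -> Prop) F phi : rep Q F ->
  (forall x, Q x -> phi x = 0) -> F phi = 0.
Proof.
move=> rF e; rewrite (@rep_eq_on _ _ _ _ (fun=> 0 - 0) rF) => [|x /e ->].
  by rewrite (rep_lin (fun=> 0) (fun=> 0) rF) subrr.
by rewrite subrr.
Qed.

Lemma rep_filter (X : Type) (Q : X -> Prop) (b : X -> bool) F : rep Q F ->
  rep (fun x => Q x /\ b x) (fun phi => F (fun x => if b x then phi x else 0)).
Proof.
move=> rF.
apply: (rep_bind (G := fun x phi => if b x then phi x else 0) rF) => x Qx.
by case E: (b x); [apply: rep_point | apply: rep0].
Qed.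

(** * The coboundary of the augmented complex of sequences *)

Section Coboundary.
Variable V : Type.
Implicit Types (s u : seq V) (phi : seq V -> K).

(* The empty sequence is the (-1)-dimensional simplex of the augmented complex
   of sequences, whose coboundary is [dl]. *)
Fixpoint dl phi s : K :=
  if s is v :: s' then phi s' - dl (fun u => phi (v :: u)) s' else 0.

Definition del (i : nat) s := take i s ++ drop i.+1 s.

Definition is_face s u := exists2 i : nat, (i < size s)%N & u = del i s.

Lemma size_del i s : (i < size s)%N -> size (del i s) = (size s).-1.
Proof.
move=> lt_i; rewrite size_cat size_take lt_i size_drop; lia.
Qed.

Lemma size_face s u : is_face s u -> size s = (size u).+1.
Proof. by move=> [i lti ->]; rewrite size_del //; lia. Qed.

Lemma dl_sum phi s :
  dl phi s = \sum_(i < size s) (-1) ^+ i * phi (del i s).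
Proof.
elim: s phi => [|v s IH] phi /=; first by rewrite big_ord0.
rewrite big_ord_recl /= mul1r /del /= drop0 IH -sumrN; congr (_ + _).
by apply: eq_bigr => i _; rewrite exprS mulN1r mulNr.
Qed.

Lemma rep_dl s : rep (is_face s) (fun phi => dl phi s).
Proof.
elim: s => [|v s IH] /=; first exact: rep0.
apply: repB; first by apply: rep_point; exists 0%N; rewrite // /del /= drop0.
by apply: (@rep_map _ _ (is_face s) _ (cons v) _ _ IH) => u [i lti ->]; exists i.+1.
Qed.

Lemma eq_dl_on phi psi s :
  (forall u, is_face s u -> phi u = psi u) -> dl phi s = dl psi s.
Proof. exact: (rep_eq_on (rep_dl s)). Qed.

Lemma dlB phi psi s : dl (fun u => phi u - psi u) s = dl phi s - dl psi s.
Proof. exact: (rep_lin _ _ (rep_dl s)). Qed.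

Lemma dl_dl phi s : dl (dl phi) s = 0.
Proof.
elim: s phi => [|v s IH] phi //=.
by rewrite dlB IH subr0 subrr.
Qed.

End Coboundary.

Lemma dl_map (V W : Type) (g : V -> W) (phi : seq W -> K) s :
  dl phi (map g s) = dl (fun u => phi (map g u)) s.
Proof. by elim: s phi => [|v s IH] phi //=; rewrite IH. Qed.

(** * Acyclic subcomplexes and Mayer-Vietoris *)

Section Acyclicity.
Variable V : Type.
Implicit Types (X Y : seq V -> bool) (z c : seq (K * seq V)).

Definition complex X := X [::] /\ forall s u, is_face s u -> X s -> X u.

(* [N] counts vertices, so this is the vanishing of the reduced simplicial
   homology of [X] in degree [N - 1]. *)
Definition acyclic N X := forall F, rep (fun s => size s = N /\ X s) F ->
  (forall phi, F (dl phi) = 0) ->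
  exists2 G, rep (fun s => size s = N.+1 /\ X s) G &
    forall phi, F phi = G (dl phi).

(** Precomposing a functional with [on b] keeps the part of its chain on simplices satisfying [b];
    chains are cut along subcomplexes in this way. *)
Definition on (b : seq V -> bool) (phi : seq V -> K) s :=
  if b s then phi s else 0.

Lemma rep_on (Q : seq V -> Prop) (b : seq V -> bool) F : rep Q F -> rep (fun s => Q s /\ b s) (fun phi => F (on b phi)).
Proof. exact: rep_filter. Qed.

Lemma eq_acyclic N X Y : X =1 Y -> acyclic N X -> acyclic N Y.
Proof.
move=> e aX F rF F0; have [|G rG FG] := aX F _ F0.
  by apply: rep_impl rF => s; rewrite e.
by exists G => //; apply: rep_impl rG => s; rewrite e.
Qed.

Lemma rep_boundary N X F : complex X ->
  rep (fun s => size s = N.+1 /\ X s) F ->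
  rep (fun s => size s = N /\ X s) (fun phi => F (dl phi)).
Proof.
move=> [_ cX] rF; apply: (rep_bind (G := fun s phi => dl phi s) rF) => s [sz Xs].
apply: rep_impl (rep_dl s) => u fu; split; last exact: cX fu Xs.
by have := size_face fu; rewrite sz => -[].
Qed.

(** A cycle in the intersection bounds [A] in [X] and [B] in [Y]. The cycle [A - B] bounds [E] in
    the union; moving the boundary of the part of [E] in [X] to [A] and that of the rest to [B]
    makes both equal to one chain [G]. *)
Lemma acyclic_cap N X Y : complex X -> complex Y ->
  acyclic N.+1 (fun s => X s || Y s) -> acyclic N X -> acyclic N Y ->
  acyclic N (fun s => X s && Y s).
Proof.
move=> cX cY aU aX aY F rF F0.
have [A rA FA] : exists2 G, rep (fun s => size s = N.+1 /\ X s) G &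
    forall phi, F phi = G (dl phi).
  by apply: aX => //; apply: rep_impl rF => s [-> /andP[]].
have [B rB FB] : exists2 G, rep (fun s => size s = N.+1 /\ Y s) G &
    forall phi, F phi = G (dl phi).
  by apply: aY => //; apply: rep_impl rF => s [-> /andP[]].
have [|phi|E rE ABE] := aU (fun phi => A phi - B phi).
- apply: repB.
    by apply: rep_impl rA => s [-> ->].
  by apply: rep_impl rB => s [-> ->]; rewrite orbT.
- by rewrite -FA -FB subrr.
pose EX phi := E (on X phi).
pose G phi := A phi - EX (dl phi).
have rEX : rep (fun s => size s = N.+2 /\ X s) EX.
  by apply: rep_impl (rep_on X rE) => s [[-> _] ->].
have rG : rep (fun s => size s = N.+1 /\ X s) G.
  by apply: repB => //; apply: rep_boundary.
pose EY phi := E (on (fun s => ~~ X s) phi).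
have rEY : rep (fun s => size s = N.+2 /\ Y s) EY.
  apply: rep_impl (rep_on _ rE) => s [[-> XY] nX].
  by move: XY; rewrite (negbTE nX).
have E_split phi : E phi = EX phi + EY phi.
  have -> : EX phi = E phi - EY phi.
    rewrite -(rep_lin _ _ rE); apply: (rep_eq_on rE) => s _.
    by rewrite /on; case: (X s); rewrite ?subr0 ?subrr.
  by rewrite subrK.
have GE phi : G phi = B phi + EY (dl phi).
  by apply/eqP; rewrite /G subr_eq addrAC -addrA -E_split -ABE addrC subrK.
have rG' : rep (fun s => size s = N.+1 /\ Y s) G.
  apply: (@rep_ext _ _ (fun phi => B phi + EY (dl phi))) => [phi|] //.
  by apply: repD => //; apply: rep_boundary.
(* [G] has one chain supported in [X] and another in [Y]; truncating the first by [Y] gives a chain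
   supported in both, with the same values. *)
exists (fun phi => G (on Y phi)).
  by apply: rep_impl (rep_on Y rG) => s [[-> ->] ->].
move=> phi; rewrite FA; transitivity (G (dl phi)); last first.
  by apply: (rep_eq_on rG') => s [_ Ys]; rewrite /on Ys.
rewrite /G -[LHS]subr0; congr (_ - _).
by rewrite (rep_eq0 rEX) // => s _; rewrite dl_dl.
Qed.

(** A cycle splits into parts in [X] and in [Y] with opposite boundaries. These lie in the
    intersection and are bounded there by [A]; correcting both parts by [A] makes them cycles. *)
Lemma acyclic_cup N X Y : complex X -> complex Y ->
  acyclic N.+1 X -> acyclic N.+1 Y -> acyclic N (fun s => X s && Y s) ->
  acyclic N.+1 (fun s => X s || Y s).
Proof.
move=> cX cY aX aY aI F rF F0.
pose FX phi := F (on X phi).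
pose FY phi := F (on (fun s => ~~ X s) phi).
have rFX : rep (fun s => size s = N.+1 /\ X s) FX.
  by apply: rep_impl (rep_on X rF) => s [[-> _] ->].
have rFY : rep (fun s => size s = N.+1 /\ Y s) FY.
  apply: rep_impl (rep_on _ rF) => s [[-> XY] nX].
  by move: XY; rewrite (negbTE nX).
have F_split phi : F phi = FX phi + FY phi.
  have -> : FX phi = F phi - FY phi.
    rewrite -(rep_lin _ _ rF); apply: (rep_eq_on rF) => s _.
    by rewrite /on; case: (X s); rewrite ?subr0 ?subrr.
  by rewrite subrK.
have dFXY phi : FX (dl phi) = - FY (dl phi).
  by apply/eqP; rewrite -subr_eq0 opprK -F_split F0.
have FX_onX phi : FX (dl phi) = FX (dl (on X phi)).
  apply: (rep_eq_on rFX) => s [_ Xs]; apply: eq_dl_on => u fu.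
  by rewrite /on (cX.2 _ _ fu Xs).
have FY_onY phi : FY (dl phi) = FY (dl (on Y phi)).
  apply: (rep_eq_on rFY) => s [_ Xs]; apply: eq_dl_on => u fu.
  by rewrite /on (cY.2 _ _ fu Xs).
(* Truncating the boundary of [FX] by [Y] loses nothing, since that boundary is also minus the
   boundary of [FY]. *)
have [|phi|A rA FA] := aI (fun phi => FX (dl (on Y phi))).
- apply: (@rep_ext _ _ (fun phi => FX (dl (on X (on Y phi))))) => [phi|].
    by rewrite -FX_onX.
  have := rep_on Y (rep_on X (rep_boundary cX rFX)).
  by apply: rep_impl => s [[[-> _] ->] ->].
- rewrite dFXY -FY_onY -dFXY.
  by rewrite (rep_eq0 rFX) // => s _; rewrite dl_dl.
have FXA phi : FX (dl phi) = A (dl phi) by rewrite -FA dFXY FY_onY -dFXY.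
have [||P rP PE] := aX (fun phi => FX phi - A phi).
- apply: repB => //.
  by apply: rep_impl rA => s [-> /andP[]].
- by move=> phi; rewrite FXA subrr.
have [||Q rQ QE] := aY (fun phi => FY phi + A phi).
- apply: repD => //.
  by apply: rep_impl rA => s [-> /andP[]].
- by move=> phi; rewrite -FXA dFXY subrr.
exists (fun phi => P phi + Q phi).
  apply: repD.
    by apply: rep_impl rP => s [-> ->].
  by apply: rep_impl rQ => s [-> ->]; rewrite orbT.
by move=> phi; rewrite F_split -PE -QE addrACA addNr addr0.
Qed.

Lemma acyclic_cup0 X Y : complex X -> acyclic 0 X ->
  acyclic 0 (fun s => X s || Y s).
Proof.
move=> cX aX F rF F0; have [||G rG FG] := aX F _ _ => //.
  by apply: rep_impl rF => s [/size0nil -> _]; rewrite cX.1.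
by exists G => //; apply: rep_impl rG => s [-> ->].
Qed.

(** The empty simplex is a cycle. A chain with this boundary is not empty, as the cochain 1 shows,
    so it contains a vertex. *)
Lemma acyclic0_neq0 X : acyclic 0 X -> X [::] ->
  exists v, X [:: v].
Proof.
move=> aX X0; have [|//|G [c [cX GE]] FG] := aX (fun phi => phi [::]).
  exact: rep_point.
case: c cX GE => [|p c] cX GE.
  by have /eqP := FG (fun=> 1); rewrite GE ev_nil oner_eq0.
have [] := cX p (or_introl erefl).
by case: p.2 => [|v [|]] //= _ Xv; exists v.
Qed.

End Acyclicity.
End Chains.

(** * Finite families of subcomplexes *)

Section Families.
Variables (K : fieldType) (V : Type) (m d : nat).
Variables (X0 : seq V -> bool) (Xs : 'I_m -> seq V -> bool).
Implicit Types (S T : {set 'I_m}).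

Definition capX S s := X0 s && [forall i, (i \in S) ==> Xs i s].
Definition cupX S T s := capX S s && [exists i, (i \in T) && Xs i s].

Hypothesis X0_complex : complex X0.
Hypothesis Xs_complex : forall i, complex (Xs i).

Lemma capX_complex S : complex (capX S).
Proof.
split; first by rewrite /capX X0_complex.1; apply/forallP => i;
  rewrite (Xs_complex i).1 implybT.
move=> s u fu /andP[Xs0 /forallP XS]; rewrite /capX (X0_complex.2 _ _ fu) //=.
by apply/forallP => i; apply/implyP => iS;
  apply: (Xs_complex i).2 fu _; apply: implyP (XS i) iS.
Qed.

Lemma cupX_complex S T : T != set0 -> complex (cupX S T).
Proof.
move=> /set0Pn[j jT]; split.
  rewrite /cupX (capX_complex S).1; apply/existsP; exists j.
  by rewrite jT (Xs_complex j).1.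
move=> s u fu /andP[XS /existsP[i /andP[iT Xi]]].
rewrite /cupX ((capX_complex S).2 _ _ fu XS); apply/existsP; exists i.
by rewrite iT ((Xs_complex i).2 _ _ fu Xi).
Qed.

Lemma capXU1 i S s : capX (i |: S) s = capX S s && Xs i s.
Proof.
rewrite /capX -andbA; congr (_ && _); apply/forallP/andP => [h|[/forallP h Xi] j].
  split; last by have /implyP := h i; apply; rewrite setU11.
  by apply/forallP => j; apply/implyP => jS;
    apply: implyP (h j) _; rewrite setU1r.
by apply/implyP; rewrite in_setU1 => /predU1P[->|] //; apply: implyP.
Qed.

Lemma cupX1 i S : cupX S [set i] =1 capX (i |: S).
Proof.
move=> s; rewrite capXU1 /cupX; congr (_ && _).
apply/existsP/idP => [[j /andP[/set1P -> //]]|Xi].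
by exists i; rewrite set11.
Qed.

Lemma cupXU1 i S T s : cupX S (i |: T) s = cupX S T s || capX (i |: S) s.
Proof.
rewrite capXU1 /cupX -andb_orr; congr (_ && _).
apply/existsP/orP => [[j]|[/existsP[j /andP[jT Xj]]|Xi]].
- rewrite in_setU1 => /andP[/predU1P[->|jT] Xj]; [by right|left].
  by apply/existsP; exists j; rewrite jT.
- by exists j; rewrite setU1r.
- by exists i; rewrite setU11.
Qed.

Lemma cupX_cap i S T s : cupX S T s && capX (i |: S) s = cupX (i |: S) T s.
Proof. by rewrite /cupX capXU1; case: (capX S s); rewrite ?andbF //= andbC. Qed.

Lemma disjoints_setU1 i S T :
  [disjoint i |: S & T] = (i \notin T) && [disjoint S & T].
Proof. by rewrite !disjoints_subset subUset sub1set inE. Qed.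

Hypothesis Xs_acyclic : forall S N,
  (0 < #|S| <= d.+1)%N -> (N + #|S| = d.+1)%N -> acyclic K N (capX S).
Hypothesis X0_high_acyclic : forall Y N, complex Y -> (forall s, Y s -> X0 s) ->
  (d < N)%N -> acyclic K N Y.

(** Adding an index [i] to the union glues in [capX (i |: S)] along [cupX (i |: S) (T :\ i)]; the
    larger [S] compensates for the degree lost in Mayer-Vietoris. The bound gains one over that of
    [capX S] because each piece intersects [#|S|.+1] sets. *)
Lemma cupX_acyclic n :
  (forall S N, (0 < #|S| < n)%N -> (d < N + #|S|)%N -> acyclic K N (capX S)) ->
  forall S T N, [disjoint S & T] -> T != set0 -> (#|S| + #|T| < n)%N ->
    (d <= N + #|S|)%N -> acyclic K N (cupX S T).
Proof.
move=> capA S T; move: {2}#|T| (erefl #|T|) => t.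
elim: t S T => [|t IH] S T Tt N dST; first by rewrite -cards_eq0 Tt.
move=> /set0Pn[i iT] ltn dN.
have iS : i \notin S by apply/negP => /(disjointFr dST); rewrite iT.
have TE : T = i |: (T :\ i) by rewrite setD1K.
have cardT := cardsD1 i T; rewrite iT Tt in cardT.
have cardS : #|i |: S| = #|S|.+1 by rewrite cardsU1 iS.
have aS M : (d <= M + #|S|)%N -> acyclic K M (capX (i |: S)).
  by move=> dM; apply: capA; rewrite cardS; lia.
have [T0|Tn0] := eqVneq (T :\ i) set0.
  apply: (eq_acyclic (X := capX (i |: S))); last exact: aS.
  by move=> s; rewrite TE T0 setU0 cupX1.
apply: (eq_acyclic (X := fun s => cupX S (T :\ i) s || capX (i |: S) s)).
  by move=> s; rewrite -cupXU1 -TE.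
have dST' : [disjoint S & T :\ i].
  by apply: disjointWr dST; rewrite subsetDl.
have cT := cupX_complex S Tn0; have cS := capX_complex (i |: S).
have aT : acyclic K N (cupX S (T :\ i)) by apply: IH => //; lia.
case: N dN aT => [|N] dN aT; first exact: acyclic_cup0.
apply: acyclic_cup => //; first exact: aS.
apply: (eq_acyclic (X := cupX (i |: S) (T :\ i))).
  by move=> s; rewrite cupX_cap.
apply: IH => //; rewrite ?cardS; [lia| |lia|lia].
by rewrite disjoints_setU1 !inE eqxx /=.
Qed.

Lemma capX_acyclic S N :
  (0 < #|S|)%N -> (d < N + #|S|)%N -> acyclic K N (capX S).
Proof.
move: {2}#|S|.+1 (ltnSn #|S|) => n; elim: n S N => // n IH U N ltUn U0 dN.
have capA S M : (0 < #|S| < n)%N -> (d < M + #|S|)%N -> acyclic K M (capX S).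
  by case/andP=> S0 Sn; apply: IH.
have [dE|dNE] := eqVneq (N + #|U|)%N d.+1.
  by apply: Xs_acyclic => //; rewrite U0 -dE leq_addl.
(* Indices move from [S] to [T] one at a time while the degree rises by one, so [M + #|S|] is
   constant. When [S] is empty the union is a subcomplex of [X0] in degree at least [d]. *)
have main S T M : S :|: T = U -> [disjoint S & T] -> T != set0 ->
    (d < M + #|S|)%N -> acyclic K M (cupX S T).
  move: {2}#|S| (erefl #|S|) => k.
  elim: k S T M => [|k IHk] S T M Sk STU dST Tn0 dM.
    apply: X0_high_acyclic; first exact: cupX_complex.
      by move=> s /andP[/andP[]].
    by rewrite Sk addn0 in dM.
  have /set0Pn[i iS] : S != set0 by rewrite -cards_eq0 Sk.
  have iT : i \notin T by apply/negP => iT; rewrite (disjointFr dST iS) in iT.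
  have cardS := cardsD1 i S; rewrite iS Sk in cardS.
  have SE : S = i |: (S :\ i) by rewrite setD1K.
  have cardU : #|U| = (#|S| + #|T|)%N.
    by rewrite -STU cardsU (disjoint_setI0 dST) cards0 subn0.
  have T1 : (0 < #|T|)%N by rewrite card_gt0.
  have dST' : [disjoint S :\ i & T] by apply: disjointWl dST; rewrite subsetDl.
  apply: (eq_acyclic (X := fun s => cupX (S :\ i) T s && capX S s)).
    by move=> s; rewrite {2}SE cupX_cap -SE.
  apply: acyclic_cap.
  - exact: cupX_complex.
  - exact: capX_complex.
  - apply: (eq_acyclic (X := cupX (S :\ i) (i |: T))).
      by move=> s; rewrite cupXU1 -SE.
    apply: IHk; [lia| | | |lia].
    + by rewrite setUA [_ :|: [set i]]setUC -SE.
    + by rewrite disjoint_sym disjoints_setU1 !inE eqxx /= disjoint_sym.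
    + by apply/set0Pn; exists i; rewrite setU11.
  - by apply: (@cupX_acyclic n) => //; lia.
  - by apply: capA; lia.
have /set0Pn[i iU] : U != set0 by rewrite -card_gt0.
have cardU := cardsD1 i U; rewrite iU in cardU.
apply: (eq_acyclic (X := cupX (U :\ i) [set i])).
  by move=> s; rewrite cupX1 setD1K.
apply: main; [by rewrite setUC setD1K| | |lia].
  by rewrite disjoint_sym disjoints1 !inE eqxx.
by apply/set0Pn; exists i; rewrite set11.
Qed.

End Families.

(** * Subdivision *)

Section Subdivision.
Variable K : fieldType.

Section OneStep.
Variables (V W : Type) (f : seq V -> W).
Implicit Types (phi : seq W -> K) (s u : seq V) (w : seq W).

(* Dual of the chain map sending [s] to the cone with apex [f s] over the
   subdivision of the boundary of [s]; the first argument bounds the depth. *)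
Fixpoint sd_rec n phi s : K :=
  if n is n'.+1 then dl (fun u => sd_rec n' (fun w => phi (f s :: w)) u) s
  else phi [::].

Definition sd phi s := sd_rec (size s) phi s.

Lemma sd_cons phi v s :
  sd phi (v :: s) = dl (sd (fun w => phi (f (v :: s) :: w))) (v :: s).
Proof.
by apply: eq_dl_on => u /size_face [su]; rewrite /sd -su.
Qed.

Lemma rep_sd (Q : seq V -> seq W -> Prop) :
  Q [::] [::] ->
  (forall s u w, is_face s u -> Q u w -> Q s (f s :: w)) ->
  forall s, rep (Q s) (fun phi => sd phi s).
Proof.
move=> Q0 Qf s; move: {2}(size s) (erefl (size s)) => n.
elim: n s => [|n IH] [|v s] // sn; first exact: rep_point.
case: sn => sn.
apply: (rep_ext (F := fun phi => dl (sd (fun w => phi (f (v :: s) :: w))) (v :: s))).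
  by move=> phi; rewrite sd_cons.
apply: (rep_bind (G := fun u phi => sd (fun w => phi (f (v :: s) :: w)) u)
  (rep_dl K (v :: s))) => u fu.
have su : size u = n by have := size_face fu; rewrite /= sn => -[].
have ru := IH u su; by apply: (rep_map (Q := Q u) _ ru) => w; apply: Qf fu.
Qed.

Lemma sdB phi psi s : sd (fun w => phi w - psi w) s = sd phi s - sd psi s.
Proof. exact: (rep_lin _ _ (@rep_sd (fun _ _ => True) I (fun _ _ _ _ _ => I) s)). Qed.

Lemma eq_sd phi psi s : phi =1 psi -> sd phi s = sd psi s.
Proof.
move=> e; apply: (rep_eq_on (@rep_sd (fun _ _ => True) I (fun _ _ _ _ _ => I) s)).
by move=> w _.
Qed.

Lemma sd_dl phi s : sd (dl phi) s = dl (sd phi) s.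
Proof.
move: {2}(size s) (erefl (size s)) => n.
elim: n phi s => [|n IH] phi [|v s] // [sn].
rewrite sd_cons.
rewrite (eq_dl_on (psi := fun u => sd phi u -
    dl (sd (fun w => phi (f (v :: s) :: w))) u)) => [|u fu].
  by rewrite dlB [X in _ - X]dl_dl subr0.
rewrite -IH -?sdB; first exact: eq_sd.
by have := size_face fu; rewrite /= sn => -[].
Qed.

End OneStep.

Lemma sd_map (V W V' W' : Type) (f : seq V -> W) (f' : seq V' -> W')
    (g : V -> V') (g' : W -> W') (phi : seq W' -> K) s :
  (forall u, u <> [::] -> f' (map g u) = g' (f u)) ->
  sd f' phi (map g s) = sd f (fun w => phi (map g' w)) s.
Proof.
move=> fg; move: {2}(size s) (erefl (size s)) => n.
elim: n phi s => [|n IH] phi [|v s] // [sn].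
have -> : sd f' phi (map g (v :: s)) = dl (sd f'
    (fun w => phi (f' (map g (v :: s)) :: w))) (map g (v :: s)) by apply: sd_cons.
rewrite fg // dl_map [RHS]sd_cons; apply: eq_dl_on => u fu.
by rewrite IH //; have := size_face fu; rewrite /= sn => -[].
Qed.

Definition bary (ws : seq (nat -> R)) : nat -> R :=
  fun k => (\sum_(w <- ws) w k) / (size ws)%:R.

Fixpoint sdN N (phi : seq (nat -> R) -> K) s : K :=
  if N is N'.+1 then sd bary (sdN N' phi) s else phi s.

(** Stands in for convexity: it is what barycentric subdivision preserves, and it holds for
    simplices and balls. *)
Definition bary_closed (W : (nat -> R) -> Prop) :=
  forall ws, ws <> [::] -> (forall x, List.In x ws -> W x) -> W (bary ws).

Definition small (D : R) (ws : seq (nat -> R)) :=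
  forall x y, List.In x ws -> List.In y ws -> forall k, `|x k - y k| <= D.

Lemma In_del (V : Type) i (s : seq V) x : List.In x (del i s) -> List.In x s.
Proof.
rewrite -{2}(cat_take_drop i s) /del => /List.in_app_iff[xi|xi];
  apply/List.in_app_iff; [by left|right].
rewrite -addn1 addnC -drop_drop in xi.
by rewrite -(cat_take_drop 1 (drop i s)); apply/List.in_app_iff; right.
Qed.

Lemma In_face (V : Type) (s u : seq V) x :
  is_face s u -> List.In x u -> List.In x s.
Proof. by move=> [i _ ->]; apply: In_del. Qed.

Lemma baryB ws (c : R) k : ws <> [::] ->
  bary ws k - c = (\sum_(w <- ws) (w k - c)) / (size ws)%:R.
Proof.
move=> ws0; rewrite sumrB mulrBl big_const_seq count_predT iter_addr_0.
by rewrite -[c *+ _]mulr_natr mulfK // pnatr_eq0; case: ws ws0.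
Qed.

Lemma ler_norm_sum_In (ws : seq (nat -> R)) (F : (nat -> R) -> R) (D : R) :
  (forall w, List.In w ws -> `|F w| <= D) ->
  `|\sum_(w <- ws) F w| <= (size ws)%:R * D.
Proof.
elim: ws => [|w ws IH] h; first by rewrite big_nil normr0 mul0r.
rewrite big_cons /= (le_trans (ler_normD _ _)) // mulrSr mulrDl mul1r addrC.
by apply: lerD; [apply: IH => x wx; apply: h; right | apply: h; left].
Qed.

Lemma ball_bary_closed (c : nat -> R) (D : R) :
  bary_closed (fun x => forall k, `|c k - x k| <= D).
Proof.
move=> ws ws0 h k; rewrite distrC baryB // normrM normfV normr_nat.
rewrite ler_pdivrMr; last by rewrite ltr0n; case: ws ws0 {h}.
rewrite mulrC; apply: ler_norm_sum_In => w iw; rewrite distrC; exact: h.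
Qed.

(** The classical mesh factor [n / (n + 1)] in dimension [n = m - 1]. *)
Definition shrink (m : nat) : R := (m.-1%:R / m%:R)%R.

(** The vertex [x] contributes 0 to the sum of differences, whence [(k - 1) / k] for [k] vertices,
    and this increases with [k]. *)
Lemma bary_small m D ws x : small D ws -> List.In x ws -> (size ws <= m)%N ->
  forall k, `|bary ws k - x k| <= shrink m * D.
Proof.
move=> sm ix sz k.
have ws0 : ws <> [::] by move=> ws0; rewrite ws0 in ix.
have D0 : 0 <= D by apply: le_trans (normr_ge0 _) (sm x x ix ix k).
have m0 : (0 < size ws)%N by case: ws ws0 {sm ix sz}.
have [l1 [l2 E]] := List.in_split _ _ ix.
rewrite baryB // normrM normfV normr_nat.
apply: (@le_trans _ _ ((size ws).-1%:R / (size ws)%:R * D)).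
  rewrite mulrAC ler_pM2r ?invr_gt0 ?ltr0n //.
  have -> : \sum_(w <- ws) (w k - x k) = \sum_(w <- l1 ++ l2) (w k - x k).
    by rewrite E -[X in X = _]/(\sum_(w <- l1 ++ x :: l2) _) !big_cat big_cons
      /= subrr add0r.
  have -> : (size ws).-1 = size (l1 ++ l2).
    by rewrite E -[List.app l1 _]/(l1 ++ x :: l2) !size_cat /= addnS.
  apply: ler_norm_sum_In => w iw; apply: sm => //; rewrite E.
  by move/List.in_app_iff: iw => [?|?]; apply/List.in_app_iff; [left|right; right].
rewrite ler_wpM2r // /shrink.
rewrite ler_pdivrMr ?ltr0n // mulrAC ler_pdivlMr ?ltr0n; last exact: leq_trans sz.
rewrite -!natrM ler_nat; nia.
Qed.

Definition piece (r : R) (s w : seq (nat -> R)) :=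
  [/\ size w = size s,
      forall W, bary_closed W -> (forall x, List.In x s -> W x) ->
        forall y, List.In y w -> W y
    & forall D, small D s -> small (r * D)%R w].

Lemma rep_sd_bary m s : (size s <= m)%N ->
  rep (piece (shrink m) s) (fun phi => sd bary phi s).
Proof.
move=> sm; pose Q s w := (size s <= m)%N -> piece (shrink m) s w.
suff : rep (Q s) (fun phi => sd bary phi s) by apply: rep_impl => w; apply.
apply: rep_sd => [_|{sm}s u w fu Qu sm].
  by split=> // D _ x y [].
have su := size_face fu.
have [] := Qu; first by rewrite su in sm; apply: ltnW.
move=> sw Ww Dw.
have s0 : s <> [::] by move=> s0; rewrite s0 in su.
split=> [|W cW Ws y /= [<-|yw]|D sD]; first by rewrite /= sw su.
- exact: cW.
- by apply: Ww yw => // x xu; apply: Ws; apply: In_face fu xu.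
(* A ball about the barycentre contains the vertices of [s], hence those of every piece of its
   boundary. *)
have bw y : List.In y w -> forall k, `|bary s k - y k| <= shrink m * D.
  move=> yw; apply: (Ww _ (@ball_bary_closed (bary s) _) _ y yw) => x xu k.
  by apply: bary_small => //; apply: In_face fu xu.
have D0 : 0 <= shrink m * D.
  case: s s0 sD {fu su Qu sm bw} => // v s _ /(_ v v (or_introl erefl) (or_introl erefl) 0%N).
  move=> /(le_trans (normr_ge0 _)) D0; apply: mulr_ge0 => //; apply: divr_ge0; exact: ler0n.
move=> x y /= [<-|xw] [<-|yw] k.
- by rewrite subrr normr0.
- exact: bw.
- by rewrite distrC; apply: bw.
- by apply: Dw => // x' y' ix iy; apply: sD; apply: In_face fu _.
Qed.

Lemma rep_sdN m N s : (size s <= m)%N ->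
  rep (piece (shrink m ^+ N) s) (fun phi => sdN N phi s).
Proof.
elim: N s => [|N IH] s sm /=.
  by apply: rep_point; split=> // D; rewrite expr0 mul1r.
apply: (rep_bind (G := fun u phi => sdN N phi u) (rep_sd_bary sm)).
move=> u [su Wu Du]; rewrite -su in sm.
apply: rep_impl (IH u sm) => w [sw Ww Dw]; split; first by rewrite sw.
  by move=> W cW Ws; apply: Ww => // x; apply: Wu.
by move=> D sD; rewrite exprSr -mulrA; apply/Dw/Du.
Qed.

Lemma sdN_dl N phi s : sdN N (dl phi) s = dl (sdN N phi) s.
Proof.
elim: N s => //= N IH s; rewrite -sd_dl; exact: eq_sd.
Qed.

Lemma eq_sdN N phi psi s : phi =1 psi -> sdN N phi s = sdN N psi s.
Proof. by move=> e; elim: N s => //= N IH s; apply: eq_sd. Qed.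

Lemma sdN_map g N phi s :
  (forall u, u <> [::] -> bary (map g u) = g (bary u)) ->
  sdN N phi (map g s) = sdN N (fun u => phi (map g u)) s.
Proof.
move=> bg; elim: N s => //= N IH s; rewrite (sd_map _ _ bg); exact: eq_sd.
Qed.

Definition unit_pt (i : nat) : nat -> R := fun k => if k == i then 1 else 0.
Definition units m := [seq unit_pt i | i <- iota 0 m].

Lemma del_units m i : (i < m.+1)%N ->
  del i (units m.+1) = [seq face i x | x <- units m].
Proof.
move=> im; rewrite /units /del -!map_take -!map_drop -map_cat -map_comp.
rewrite take_iota drop_iota (minn_idPl (ltnW im)) add0n subSS.
have -> : iota 0 m = iota 0 i ++ iota i (m - i).
  by rewrite -iotaD subnKC.
have face_unit j : face i (unit_pt j) = unit_pt (bump i j).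
  apply: functional_extensionality => k; rewrite /face /unit_pt /bump -[ltn k i]/((k < i)%N).
  case: (ltngtP k i) => ki.
  - by congr (if _ then _ else _); case: (leqP i j) => ij; rewrite ?add1n; lia.
  - by congr (if _ then _ else _); case: (leqP i j) => ij; rewrite ?add1n; lia.
  - by subst k; rewrite ifN //; case: (leqP i j) => ij; rewrite ?add1n; lia.
rewrite !map_cat; congr (_ ++ _).
  apply/eq_in_map => j; rewrite mem_iota add0n /= face_unit /bump => ji.
  by rewrite leqNgt ji.
rewrite -addn1 addnC iotaDl -map_comp; apply/eq_in_map => j.
by rewrite mem_iota /= face_unit /bump => /andP[-> _].
Qed.

Lemma bary_face i ws : ws <> [::] ->
  bary (map (face i) ws) = face i (bary ws).
Proof.
move=> _; apply: functional_extensionality => k.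
rewrite /bary /face size_map big_map.
by case: ifP => _ //; case: ifP => _ //; rewrite big1 // mul0r.
Qed.

Section Labelled.
Variables (C : Type) (f : seq C -> C).

(** The standard simplex with [m] vertices is subdivided [N] times and its vertices are labelled by
    [s]; the outer [sd f] then subdivides the label sequences formally, which turns unordered
    comparable labels into ordered ones when [f] takes unions. *)
Definition label_sd N m (phi : seq C -> K) (s : (nat -> R) -> C) : K :=
  sdN N (fun ws => sd f phi (map s ws)) (units m).

(** Both subdivisions commute with [dl] and are natural for face inclusions, so this is a chain map
    from singular simplices to sequences of labels. *)
Lemma label_sd_dl N m phi s :
  label_sd N m.+1 (dl phi) s =
  \sum_(i < m.+1) (-1) ^+ i * label_sd N m phi (fun t => s (face i t)).
Proof.
rewrite /label_sd (eq_sdN _ _ (psi := dl (fun ws => sd f phi (map s ws)))).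
  rewrite sdN_dl dl_sum size_map size_iota; apply: eq_bigr => i _; congr (_ * _).
  rewrite del_units // sdN_map; last exact: bary_face.
  by apply: eq_sdN => ws; rewrite -map_comp.
by move=> ws; rewrite sd_dl dl_map.
Qed.

Lemma label_sd0 N phi s : label_sd N 0 phi s = phi [::].
Proof. by rewrite /label_sd; elim: N. Qed.

End Labelled.
End Subdivision.

(** * Standard simplices and uniform continuity *)

Lemma std_simplexP n t : std_simplex n t <->
  [/\ forall k, (k <= n)%N -> 0 <= t k, forall k, (n < k)%N -> t k = 0
    & \sum_(k < n.+1) t k = 1].
Proof.
rewrite /std_simplex sum_f_R0E big_mkord; split=> [[h0 [h1 h2]]|[h0 h1 h2]].
  by split=> // k kn; apply/RleP/h0.
by split=> [k kn|]; first by apply/RleP/h0.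
Qed.

Lemma std_simplex_le1 n t k : std_simplex n t -> t k <= 1.
Proof.
move=> /std_simplexP[t0 tn t1]; case: (leqP k n) => kn; last by rewrite tn.
rewrite -t1 (bigD1 (Ordinal (kn : (k < n.+1)%N))) //= lerDl sumr_ge0 // => i _.
by apply: t0; rewrite -ltnS.
Qed.

Lemma std_simplex_bary n : bary_closed (std_simplex n).
Proof.
move=> ws ws0 h.
have hP x := proj1 (std_simplexP n x).
apply/std_simplexP; split=> [k kn|k kn|].
- rewrite /bary divr_ge0 ?ler0n //.
  elim: ws h {ws0} => [|w ws IH] h; first by rewrite big_nil.
  rewrite big_cons addr_ge0 ?IH // => [|x xw]; last by apply: h; right.
  by have [] := hP w (h w (or_introl erefl)) => /(_ k kn).
- rewrite /bary (_ : \sum_(w <- ws) w k = 0) ?mul0r //.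
  elim: ws h {ws0} => [|w ws IH] h; first by rewrite big_nil.
  rewrite big_cons IH => [|x xw]; last by apply: h; right.
  by have [_ /(_ k kn) ->] := hP w (h w (or_introl erefl)); rewrite addr0.
- rewrite /bary -mulr_suml exchange_big /=.
  suff -> : \sum_(w <- ws) \sum_(k < n.+1) w k = (size ws)%:R.
    by rewrite divff // pnatr_eq0; case: ws ws0 {h}.
  elim: ws h {ws0} => [|w ws IH] h; first by rewrite big_nil.
  rewrite big_cons IH => [|x xw]; last by apply: h; right.
  have [_ _ ->] := hP w (h w (or_introl erefl)).
  by rewrite /= -add1n natrD.
Qed.

Lemma In_map_mem (T : eqType) (V : Type) (f : T -> V) s x :
  List.In x (map f s) -> exists2 i, i \in s & x = f i.
Proof.
elim: s => //= i s IH [<-|/IH[j js ->]]; first by exists i; rewrite ?mem_head.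
by exists j; rewrite // in_cons js orbT.
Qed.

Lemma units_std n x : List.In x (units n.+1) -> std_simplex n x.
Proof.
move=> xu; have [i + ->] := @In_map_mem nat _ unit_pt (iota 0 n.+1) x xu.
rewrite mem_iota => lti.
apply/std_simplexP; rewrite /unit_pt; split=> [k _|k kn|].
- by case: ifP.
- by rewrite gtn_eqF // (leq_trans lti).
rewrite (bigD1 (Ordinal lti)) //= eqxx big1 ?addr0 // => j.
by rewrite -val_eqE /= => /negbTE ->.
Qed.

Lemma units_small n : small 1%R (units n.+1).
Proof.
move=> x y /units_std xs /units_std ys k.
have x1 := std_simplex_le1 k xs; have y1 := std_simplex_le1 k ys.
have ge0 z : std_simplex n z -> 0 <= z k.
  by move=> /std_simplexP[z0 zn _]; case: (leqP k n) => kn; [apply: z0|rewrite zn].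
have := ge0 _ xs; have := ge0 _ ys; rewrite ler_norml; lra.
Qed.

Lemma shrink_lt m (delta : R) : 0 < delta ->
  exists N, forall M, (N <= M)%N -> shrink m ^+ M < delta.
Proof.
move=> /RltP d0; have s1 : (Rabs (shrink m) < 1)%coqR.
  apply/RltP; rewrite RealsE /shrink normrM normfV !normr_nat.
  case: m => [|m]; first by rewrite mul0r.
  by rewrite ltr_pdivrMr ?ltr0n // mul1r ltr_nat.
have [N hN] := pow_lt_1_zero _ s1 _ d0.
exists N => M NM; have /RltP := hN M (elimT ssrnat.leP NM).
by rewrite !RealsE; apply: le_lt_trans; apply: ler_norm.
Qed.

(** * Uniform continuity from compactness of a box *)

Section UniformContinuity.

Fixpoint Tn_fun m : Compactness.Tn m R -> nat -> R :=
  match m with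
  | 0%N => fun _ _ => 0
  | m'.+1 => fun x k => if k is k'.+1 then Tn_fun x.2 k' else x.1
  end.

Fixpoint fun_Tn m (t : nat -> R) : Compactness.Tn m R :=
  match m with
  | 0%N => tt
  | m'.+1 => (t 0%N, fun_Tn m' (fun k => t k.+1))
  end.

Lemma fun_TnK m t k : (k < m)%N -> Tn_fun (fun_Tn m t) k = t k.
Proof. by elim: m t k => // m IH t [|k] //= km; rewrite IH. Qed.

Lemma Tn_fun_ge m (x : Compactness.Tn m R) k : (m <= k)%N -> Tn_fun x k = 0.
Proof. by elim: m x k => // m IH x [|k] //= km; rewrite IH. Qed.

Lemma bounded_fun_Tn m t : (forall k, 0 <= t k <= 1) ->
  Compactness.bounded_n m (fun_Tn m (fun=> 0)) (fun_Tn m (fun=> 1)) (fun_Tn m t).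
Proof.
elim: m t => //= m IH t t01; split; last exact: IH.
by have /andP[/RleP ? /RleP] := t01 0%N.
Qed.

Lemma close_Tn_fun m delta (x y : Compactness.Tn m R) : Compactness.close_n m delta x y ->
  forall k, (k < m)%N -> `|Tn_fun x k - Tn_fun y k| < delta.
Proof.
elim: m x y => // m IH [x0 x] [y0 y] /= [/RltP h0 h] [|k] km /=.
  by rewrite RealsE in h0.
exact: IH.
Qed.

(** Compactness of the box needs a radius at points off the simplex too; it comes from a negative
    coordinate or from a coordinate sum other than 1. *)
Lemma std_simplex_ball n (tau : nat -> R) :
  (forall k, (n < k)%N -> tau k = 0) -> ~ std_simplex n tau ->
  exists2 delta : R, 0 < delta & forall t, std_simplex n t ->
    ~ (forall k, (k <= n)%N -> `|t k - tau k| < delta).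
Proof.
move=> tn nst.
have [[k [kn tk]]|h] := EM (exists k, (k <= n)%N /\ tau k < 0).
  exists (- tau k) => [|t /std_simplexP[t0 _ _] h]; first by rewrite oppr_gt0.
  have := h k kn; have := t0 k kn; rewrite ltr_norml => ?; lra.
pose s := \sum_(k < n.+1) tau k.
have s1 : s != 1.
  apply/eqP => s1; apply: nst; apply/std_simplexP; split=> // k kn.
  by case: leP => // tk; case: h; exists k.
have n0 : 0 < n.+1%:R :> R by rewrite ltr0n.
exists (`|1 - s| / n.+1%:R) => [|t /std_simplexP[_ _ t1] hk].
  by rewrite divr_gt0 // normr_gt0 subr_eq0 eq_sym.
have : `|1 - s| < `|1 - s|; last by rewrite ltxx.
rewrite -{1}t1 -sumrB (le_lt_trans (ler_norm_sum _ _ _)) //.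
have -> : `|1 - s| = \sum_(k < n.+1) (`|1 - s| / n.+1%:R).
  by rewrite sumr_const card_ord -[RHS]mulr_natr divfK // gt_eqF.
apply: ltr_sum => [|k _]; last by apply: hk; rewrite -ltnS.
by apply/hasP; exists ord0; rewrite ?mem_index_enum.
Qed.

Lemma sing_simplex_uniform d (A : rset d) n s : sing_simplex A n s ->
  forall eps : R, 0 < eps -> exists2 delta : R, 0 < delta &
    forall t t', std_simplex n t -> std_simplex n t' ->
      (forall k, `|t k - t' k| <= delta) -> forall j, `|s t j - s t' j| < eps.
Proof.
move=> [_ cont] eps e0; pose e2 := eps / 2; have e20 : 0 < e2 by rewrite /e2; lra.
have e2E : e2 + e2 = eps by rewrite /e2; field.
pose good (x : Compactness.Tn n.+1 R) (delta : posreal) := forall t t',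
  std_simplex n t -> std_simplex n t' ->
  (forall k, (k <= n)%N -> `|t k - Tn_fun x k| < pos delta) ->
  (forall k, (k <= n)%N -> `|t' k - t k| < pos delta) ->
  forall j, `|s t j - s t' j| < eps.
have ex_good x : exists delta, good x delta.
  have [st|nst] := EM (std_simplex n (Tn_fun x)); last first.
    have [|delta d0 hd] := std_simplex_ball _ nst.
      by move=> k kn; apply: Tn_fun_ge.
    exists (mkposreal _ (elimT RltP d0)) => t t' tS _ h.
    by case: (hd t tS).
  have [delta [/RltP dpos hd]] := cont _ st e2 (elimT RltP e20).
  have d0 : 0 < delta := dpos.
  have d2 : 0 < delta / 2 by lra.
  exists (mkposreal _ (elimT RltP d2)) => t t' tS tS' /= h h' j.
  have /RltP : (Rabs (s t j - s (Tn_fun x) j) < e2)%coqR.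
    apply: hd => // k kn; apply/RltP; rewrite !RealsE.
    by apply: lt_le_trans (h k kn) _; lra.
  have /RltP : (Rabs (s t' j - s (Tn_fun x) j) < e2)%coqR.
    apply: hd => // k kn; apply/RltP; rewrite !RealsE.
    rewrite (_ : t' k - _ = (t' k - t k) + (t k - Tn_fun x k)); last by ring.
    apply: le_lt_trans (ler_normD _ _) _.
    by have := h k kn; have := h' k kn; lra.
  rewrite !RealsE !ltr_norml; lra.
pose delta x := proj1_sig (cid (ex_good x)).
have deltaP x : good x (delta x).
  exact: proj2_sig (cid (ex_good x)).
have [d0 hd] := Compactness.compactness_value n.+1 (fun_Tn _ (fun=> 0)) (fun_Tn _ (fun=> 1)) delta.
have d0_gt0 : 0 < pos d0 by apply/RltP; apply: cond_pos.
exists (pos d0 / 2) => [|t t' tS tS' h j]; first by lra.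
have t01 k : 0 <= t k <= 1.
  rewrite (std_simplex_le1 _ tS) andbT.
  by case/std_simplexP: tS => t0 tn _; case: (leqP k n) => kn; [apply: t0|rewrite tn].
(* [d0] acts as a Lebesgue number: [t] lies in the ball of some [x] whose radius is at least
   [d0]. *)
have /contrapT [x [_ [/close_Tn_fun cl /RleP dx]]] := hd _ (bounded_fun_Tn n.+1 t01).
apply: (deltaP x) => // k kn.
  by have := cl k kn; rewrite fun_TnK.
apply: lt_le_trans dx; rewrite distrC.
by apply: le_lt_trans (h k) _; lra.
Qed.

End UniformContinuity.

(** * Singular chains and affine simplices *)

Section SingularChains.
Variables (K : fieldType) (d : nat).
Implicit Types (c b : chain K d) (f : smap d -> K).

Definition respects n f := forall s s' : smap d,
  (forall t, std_simplex n t -> s t = s' t) -> f s = f s'.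

Lemma same_simplexP n (s s' : smap d) :
  reflect (forall t, std_simplex n t -> s t = s' t) (same_simplex n s s').
Proof.
by rewrite /same_simplex; case: excluded_middle_informative => h; constructor.
Qed.

Lemma same_simplex_refl n (s : smap d) : same_simplex n s s.
Proof. exact/same_simplexP. Qed.

Lemma same_simplex_sym n (s s' : smap d) : same_simplex n s s' -> same_simplex n s' s.
Proof. by move=> /same_simplexP h; apply/same_simplexP => t /h. Qed.

Lemma same_simplex_trans n (s2 s1 s3 : smap d) :
  same_simplex n s1 s2 -> same_simplex n s2 s3 -> same_simplex n s1 s3.
Proof.
move=> /same_simplexP h /same_simplexP h'; apply/same_simplexP => t tS.
by rewrite h ?h'.
Qed.

Lemma ev_filter (X : Type) (c : seq (K * X)) (a : X -> bool) phi :
  ev [seq p <- c | a p.2] phi = ev c (fun x => if a x then phi x else 0).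
Proof.
rewrite /ev big_filter big_mkcond; apply: eq_bigr => p _.
by case: ifP => _ //; rewrite mulr0.
Qed.

Lemma coefE n c s :
  coef n c s = ev c (fun s' => if same_simplex n s' s then 1 else 0).
Proof.
by apply: eq_bigr => p _; case: ifP => _; rewrite ?mulr1 ?mulr0.
Qed.

(** Induction on the length: the simplices equal to the first one have total coefficient 0, and
    deleting them leaves a zero chain. *)
Lemma chain_zero_ev n c f : chain_zero n c -> respects n f -> ev c f = 0.
Proof.
move=> c0 rf; have [k] := ubnP (size c); elim: k c c0 => // k IH c c0 sk.
case E: c => [|p c']; first by rewrite ev_nil.
rewrite -E.
pose a s := same_simplex n s p.2.
have -> : ev c f = f p.2 * coef n c p.2 + ev [seq q <- c | ~~ a q.2] f.
  rewrite coefE (ev_filter c (fun s => ~~ a s)) -evZ -evD; apply: eq_ev => s.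
  rewrite /a; case: ifP => /= [/same_simplexP/rf ->|_].
    by rewrite mulr1 addr0.
  by rewrite mulr0 add0r.
rewrite c0 mulr0 add0r; apply: IH => [s|]; last first.
  rewrite size_filter -ltnS; apply: leq_trans sk; rewrite ltnS E /= /a same_simplex_refl.
  by rewrite add0n ltnS count_size.
rewrite coefE (ev_filter c (fun s => ~~ a s)).
case ap: (a s); last first.
  rewrite -[RHS](c0 s) coefE; apply: eq_ev => s'.
  case ap': (a s') => //=; case: ifP => // s's; move: ap.
  rewrite /a => /negbT/negP[]; apply: same_simplex_trans ap'.
  exact: same_simplex_sym.
rewrite (@eq_ev _ _ _ _ (fun=> 0)) ?ev0 // => s'.
case ap': (a s') => //=; case: ifP => // s's; move: ap'.
by move=> /negbT/negP[]; apply: same_simplex_trans ap.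
Qed.

Lemma ev_flatten (X Y : Type) (c : seq X) (F : X -> seq (K * Y)) phi :
  ev (flatten [seq F p | p <- c]) phi = \sum_(p <- c) ev (F p) phi.
Proof.
elim: c => [|p c IH] /=; first by rewrite ev_nil big_nil.
by rewrite ev_cat IH big_cons.
Qed.

Lemma ev_bd n c f : ev (bd n c) f =
  ev c (fun s => \sum_(i < n.+1) (-1) ^+ i * f (fun t => s (face i t))).
Proof.
rewrite /bd ev_flatten; apply: eq_bigr => p _.
rewrite /ev big_map (_ : iota _ _ = index_iota 0 n.+1) ?big_mkord ?mulr_sumr; last first.
  by rewrite /index_iota subn0.
by apply: eq_bigr => i _; rewrite mulrCA mulrA.
Qed.

Lemma ev_chain_sub c b f : ev (chain_sub c b) f = ev c f - ev b f.
Proof.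
rewrite ev_cat; congr (_ + _); rewrite /ev big_map -sumrN.
by apply: eq_bigr => p _; rewrite mulNr.
Qed.

End SingularChains.

(** * Affine simplices and affine forms *)

Section AffineSimplices.
Variable d : nat.
Implicit Types (ps : seq (pt d)) (g : pt d * R).

Fixpoint aff ps : smap d :=
  if ps is p :: ps' then fun t j => (t 0%N * p j + aff ps' (fun k => t k.+1) j)%R
  else fun _ _ => 0%R.

Lemma aff_face ps i t : (i < size ps)%N -> aff ps (face i t) = aff (del i ps) t.
Proof.
elim: ps i t => // p ps IH [|i] t lti; apply: functional_extensionality => j.
  by rewrite /del /= drop0 mul0r add0r.
rewrite -[del i.+1 _]/(p :: del i ps) /= -IH //; congr (_ + aff ps _ j).
by apply: functional_extensionality => -[|k]; rewrite /face //; case: (i).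
Qed.

Definition hval g (x : pt d) : R := (\sum_j g.1 j * x j + g.2)%R.

Lemma hval_aff_le0 g ps (n : nat) t : size ps = n.+1 -> std_simplex n t ->
  (forall p, List.In p ps -> hval g p <= 0) -> hval g (aff ps t) <= 0.
Proof.
move=> sp /std_simplexP[t0 _ t1] hp.
(* Multiplying the constant term by the coordinate sum makes the claim homogeneous in [t], which
   allows induction on [ps]. *)
rewrite /hval -[g.2]mulr1 -t1 -sp.
have {}t0 k : (k < size ps)%N -> 0 <= t k by rewrite sp; apply: t0.
elim: ps t {t1 sp} t0 hp => [|p ps IH] t t0 hp /=.
  by rewrite big_ord0 mulr0 addr0 big1 // => j _; rewrite mulr0.
rewrite big_ord_recl mulrDr; under eq_bigr do rewrite mulrDr.
rewrite big_split /= addrACA; apply: ler_wnDl; last first.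
  by apply: IH => [k ks|q qs]; [apply: t0 | apply: hp; right].
have -> : \sum_(j < d) g.1 j * (t 0%N * p j) + g.2 * t 0%N = t 0%N * hval g p.
  rewrite /hval mulrDr mulr_sumr [t 0%N * g.2]mulrC; congr (_ + _).
  by apply: eq_bigr => j _; rewrite mulrCA.
by apply: mulr_ge0_le0; [apply: t0 | apply: hp; left].
Qed.

Lemma aff_lipschitz ps : exists2 C : R, 0 <= C & forall s t (D : R),
  (forall k, (k < size ps)%N -> `|s k - t k| <= D) ->
  forall j, `|aff ps s j - aff ps t j| <= C * D.
Proof.
elim: ps => [|p ps [C C0 hC]].
  by exists 0 => // s t D _ j; rewrite /= subrr normr0 mul0r.
exists ((\sum_j `|p j|) + C) => [|s t D h j /=].
  by rewrite addr_ge0 // sumr_ge0.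
rewrite [leRHS]mulrDl opprD addrACA -mulrBl (le_trans (ler_normD _ _)) // lerD //.
  rewrite normrM mulrC ler_pM //; last exact: h.
  by rewrite (bigD1 j) //= lerDl sumr_ge0.
by apply: hC => k ks; apply: h.
Qed.

Lemma sing_simplex_aff (A : rset d) n ps : size ps = n.+1 ->
  (forall t, std_simplex n t -> A (aff ps t)) -> sing_simplex A n (aff ps).
Proof.
move=> sp hA; split=> // t tS eps /RltP e0.
have [C C0 hC] := aff_lipschitz ps.
have e0' : 0 < eps := e0.
have C1 : 0 < C + 1 by lra.
exists (eps / (C + 1))%R; split; first by apply/RltP/divr_gt0.
move=> s sS h j; apply/RltP; rewrite RabsE -[(_ - _)%coqR]/(aff ps s j - aff ps t j).
apply: (@le_lt_trans _ _ (C * (eps / (C + 1)))).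
  apply: hC => k; rewrite sp ltnS => kn.
  have /RltP := h k kn; rewrite RabsE => /ltW; exact.
by rewrite mulrA ltr_pdivrMr //; nra.
Qed.

End AffineSimplices.

(** * Cells of an arrangement and flags *)

Section Cells.
Variables (K : fieldType) (d : nat) (I : finType) (h : I -> pt d * R).
Implicit Types (x y : pt d) (c : {set I}) (s u w : seq {set I}) (A : rset d).

(** When the forms are closed under negation, the positive ones determine all signs, so this set
    names the cell of [x]. *)
Definition pos x : {set I} := [set i | 0 < hval (h i) x].

Definition realizable c : bool := `[< exists x, pos x = c >].

Definition cell_pt c : pt d :=
  if pselect (exists x, pos x = c) is left e then projT1 (cid e) else fun=> 0%R.

Lemma pos_cell_pt c : realizable c -> pos (cell_pt c) = c.
Proof.
by move=> /asboolP rc; rewrite /cell_pt; case: pselect => // e; case: cid.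
Qed.

Lemma realizable_pos x : realizable (pos x).
Proof. by apply/asboolP; exists x. Qed.

(* [A] is a closed union of cells of the arrangement: [pos y \subset pos x]
   says that [y] lies in the closure of the cell of [x]. *)
Definition cell_closed A := forall x y, A x -> pos y \subset pos x -> A y.

Definition supset (a b : {set I}) := b \subset a.
Definition psupset (a b : {set I}) := b \proper a.

(** Neighbouring vertices may get equal labels, so the chain maps land in weak flags; the length
    bound holds for strict ones. *)
Definition weak_flag s := sorted supset s && all realizable s.

Definition strict s := sorted psupset s.

Definition flag s := strict s && all realizable s.

Definition cells_in A s := all (fun c => `[< A (cell_pt c) >]) s.

Definition flags_in A s := flag s && cells_in A s.

Lemma all_face (V : Type) (a : pred V) (s u : seq V) :
  is_face s u -> all a s -> all a u.
Proof.
move=> [i _ ->]; rewrite -{1}(cat_take_drop i s) /del !all_cat => /andP[-> /=].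
by rewrite -addn1 addnC -drop_drop; case: (drop i s) => //= v s' /andP[]; rewrite drop0.
Qed.

Lemma is_face_subseq (V : eqType) (s u : seq V) : is_face s u -> subseq u s.
Proof.
move=> [i _ ->]; rewrite -{2}(cat_take_drop i s) /del cat_subseq //.
by rewrite -addn1 addnC -drop_drop; case: (drop i s) => // v s'; rewrite drop1; apply: subseq_cons.
Qed.

Lemma psupset_trans : transitive psupset.
Proof. by move=> b a c ba cb; apply: proper_trans cb ba. Qed.

Lemma supset_trans : transitive supset.
Proof. by move=> b a c ba cb; apply: subset_trans cb ba. Qed.

Lemma flags_in_complex A : complex (flags_in A).
Proof.
split=> // s u fu /andP[/andP[st rs] As]; rewrite /flags_in /flag /cells_in.
rewrite !(all_face fu) // !andbT.
exact: subseq_sorted psupset_trans _ _ (is_face_subseq fu) st.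
Qed.

Lemma strict_weak s : strict s -> sorted supset s.
Proof. by apply: sub_sorted => a b /proper_sub. Qed.

Lemma top_subset t s c : weak_flag (t :: s) -> c \in t :: s -> c \subset t.
Proof.
move=> /andP[]; rewrite /= (path_sortedE supset_trans) => /andP[/allP ts _] _.
by rewrite in_cons => /predU1P[->|/ts].
Qed.

(* A weakly decreasing sequence that is not strict repeats two adjacent
   entries, so cochains vanishing on such sequences form a subcomplex. *)
Lemma dl_repeat (phi : seq {set I} -> K) s :
  (forall w, ~~ sorted (fun a b : {set I} => a != b) w -> phi w = 0) ->
  ~~ sorted (fun a b : {set I} => a != b) s -> dl phi s = 0.
Proof.
elim: s phi => // a [|b s] IH phi phi0 //= .
rewrite negb_and negbK => /orP[/eqP <-|ns].
  rewrite subKr; apply: (rep_eq0 (rep_dl K s)) => u _.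
  by rewrite phi0 //= eqxx.
rewrite phi0 // sub0r; apply/eqP; rewrite oppr_eq0; apply/eqP.
apply: (IH (fun u => phi (a :: u))) => // w nw; apply: phi0.
by apply: contra nw => /=; apply: path_sorted.
Qed.

Lemma sorted_neq_strict s : sorted supset s ->
  sorted (fun a b : {set I} => a != b) s = strict s.
Proof.
elim: s => // a [|b s] IH //= /andP[ba bs]; rewrite [RHS]/=.
have -> : psupset a b = (a != b).
  by rewrite /psupset properEneq -/(supset a b) ba andbT eq_sym.
by congr (_ && _); apply: IH.
Qed.

Lemma dl_on_strict (phi : seq {set I} -> K) s :
  sorted supset s ->
  dl (on strict phi) s = on strict (dl phi) s.
Proof.
move=> ws; rewrite {2}/on; case: ifP => st.
  apply: eq_dl_on => u fu; rewrite /on ifT //.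
  exact: subseq_sorted psupset_trans _ _ (is_face_subseq fu) st.
apply: dl_repeat; last by rewrite sorted_neq_strict ?st.
move=> w nw; rewrite /on ifN //; apply: contra nw => st'.
by rewrite sorted_neq_strict ?strict_weak.
Qed.

Definition join_cells s : {set I} := \bigcup_(c <- s) c.

Lemma sub_join_cells s c : c \in s -> c \subset join_cells s.
Proof. by move=> cs; rewrite /join_cells (big_rem c) //= subsetUl. Qed.

Lemma join_cells_sub s (B : {set I}) :
  (forall c, c \in s -> c \subset B) -> join_cells s \subset B.
Proof.
move=> sB; rewrite /join_cells big_seq.
by elim/big_ind: _ => [|X Y XB YB|c /sB//]; rewrite ?sub0set // subUset XB.
Qed.

Definition comparable_cells s := forall a b, a \in s -> b \in s ->
  (a \subset b) || (b \subset a).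

Lemma join_cells_mem s : comparable_cells s -> s != [::] -> join_cells s \in s.
Proof.
elim: s => // a [|b s] IH cs _; first by rewrite /join_cells big_seq1 mem_head.
have /IH/(_ isT) js : comparable_cells (b :: s).
  by move=> x y xs ys; apply: cs; rewrite in_cons ?xs ?ys orbT.
rewrite /join_cells big_cons -/(join_cells (b :: s)).
have js' : join_cells (b :: s) \in a :: b :: s by rewrite in_cons js orbT.
have /orP[/setUidPr->//|/setUidPl->] := cs a _ (mem_head _ _) js'.
exact: mem_head.
Qed.

Lemma mem_face (V : eqType) (s u : seq V) (x : V) : is_face s u -> x \in u -> x \in s.
Proof. by move=> /is_face_subseq/mem_subseq; apply. Qed.

(** The union of comparable cells is the largest of them. Hence each apex is realizable, satisfies
    [P] and contains every cell of the piece it is put on. *)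
Lemma rep_sd_join (P : pred {set I}) s : comparable_cells s ->
  all realizable s -> all P s ->
  rep (fun w => [/\ size w = size s, weak_flag w & all P w])
    (fun phi : seq {set I} -> K => sd join_cells phi s).
Proof.
move=> cs rs Ps; pose Q s w := comparable_cells s -> all realizable s -> all P s ->
  [/\ size w = size s, weak_flag w, all P w
    & all (fun c => c \subset join_cells s) w].
suff : rep (Q s) (fun phi : seq {set I} -> K => sd join_cells phi s).
  by apply: rep_impl => w /(_ cs rs Ps)[].
apply: rep_sd => [|{rs Ps}{}s u w fu Qu {}cs rs Ps]; first by split.
have [|||sw /andP[ww rw] Pw jw] := Qu; rewrite ?(all_face fu) //.
  by move=> a b au bu; apply: cs; apply: mem_face fu _.
have s0 : s != [::].
  by apply/eqP => s0; have := size_face fu; rewrite s0.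
have js := join_cells_mem cs s0.
have sub_uj : join_cells u \subset join_cells s.
  apply: join_cells_sub => c cu; apply: sub_join_cells; exact: mem_face fu cu.
have jsw : all (fun c => c \subset join_cells s) w.
  by apply: sub_all jw => c cj; apply: subset_trans cj sub_uj.
split.
- by rewrite /= sw (size_face fu).
- rewrite /weak_flag /= (allP rs _ js) rw !andbT.
  by rewrite (path_sortedE supset_trans); apply/andP; split.
- by rewrite /= (allP Ps _ js) Pw.
- by rewrite /= subxx jsw.
Qed.

End Cells.

(** * Comparison of singular and simplicial homology *)

Section Comparison.
Variables (K : fieldType) (d : nat) (I : finType) (h : I -> pt d * R).
Variables (eps : R) (v : pt d -> {set I}).
Hypothesis eps_gt0 : 0 < eps.
Hypothesis v_realizable : forall y, realizable h (v y).
Hypothesis v_pos : forall y, v y \subset pos h y.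
Hypothesis v_comparable : forall y y', (forall j, `|y j - y' j| < eps) ->
  (v y \subset v y') || (v y' \subset v y).

(** The number of subdivisions needed depends on the simplex; finitely many simplices share one. *)
Definition eventually (P : nat -> Prop) := exists N0, forall N, (N0 <= N)%N -> P N.

Lemma eventuallyW (P Q : nat -> Prop) :
  (forall N, P N -> Q N) -> eventually P -> eventually Q.
Proof. by move=> PQ [N0 h0]; exists N0 => N /h0 /PQ. Qed.

Lemma eventually_and (P Q : nat -> Prop) :
  eventually P -> eventually Q -> eventually (fun N => P N /\ Q N).
Proof.
move=> [M hM] [N hN]; exists (maxn M N) => k; rewrite geq_max => /andP[Mk Nk].
by split; [apply: hM | apply: hN].
Qed.

Lemma eventually_In (X : Type) (c : seq X) (P : X -> nat -> Prop) :
  (forall x, List.In x c -> eventually (P x)) ->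
  eventually (fun N => forall x, List.In x c -> P x N).
Proof.
elim: c => [|x c IH] hc; first by exists 0%N.
have := eventually_and (hc x (or_introl erefl)) (IH (fun y yc => hc y (or_intror yc))).
by apply: eventuallyW => N [Px Pc] y /= [<-|/Pc].
Qed.

Notation join := (@join_cells I).

(** After enough subdivisions, uniform continuity brings the images of the vertices of each piece
    within [eps], so their labels are comparable. The labels stay in [A] because [v y] is in the
    closure of the cell of [y]. *)
Lemma rep_label A n s : cell_closed h A -> sing_simplex A n s ->
  eventually (fun N =>
    rep (fun w => [/\ size w = n.+1, weak_flag h w & cells_in h A w])
      (fun phi : seq {set I} -> K => label_sd join N n.+1 phi (fun t => v (s t)))).
Proof.
move=> cA sA; have [delta d0 hd] := sing_simplex_uniform sA eps_gt0.
have [N0 hN0] := shrink_lt n.+1 d0; exists N0 => N /hN0 sN.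
have szu : (size (units n.+1) <= n.+1)%N by rewrite size_map size_iota.
apply: (rep_bind (G := fun ws phi => sd join phi (map (fun t => v (s t)) ws))
  (rep_sdN K N szu)) => ws [sws Wws Dws].
have stdw x : List.In x ws -> std_simplex n x.
  by move=> xw; apply: (Wws _ (@std_simplex_bary n) _ x xw) => y; apply: units_std.
have smw x y : List.In x ws -> List.In y ws -> forall k, `|x k - y k| <= delta.
  move=> xw yw k; have := Dws _ (@units_small n) x y xw yw k.
  by rewrite mulr1 => /le_trans; apply; apply: ltW.
have mapP c : c \in [seq v (s t) | t <- ws] -> exists2 t, List.In t ws & c = v (s t).
  elim: ws {sws Wws Dws stdw smw} => //= t ws IH.
  rewrite in_cons => /predU1P[->|/IH[t' tw ->]]; first by exists t; rewrite //; left.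
  by exists t' => //; right.
have r := @rep_sd_join K d I h (fun c => `[< A (cell_pt h c) >])
  [seq v (s t) | t <- ws].
apply: rep_impl (r _ _ _) => [w [-> ww Aw]|a b /mapP[t tw ->] /mapP[t' tw' ->]||].
- by split; rewrite // size_map sws size_map size_iota.
- by apply: v_comparable => j; apply: hd; [exact: stdw | exact: stdw | exact: smw].
- by apply/allP => c /mapP[t _ ->].
- apply/allP => c /mapP[t tw ->]; apply/asboolP; apply: cA (sA.1 t (stdw t tw)) _.
  by rewrite pos_cell_pt.
Qed.

Lemma repT_label N m s : rep (fun _ => True)
  (fun phi : seq {set I} -> K => label_sd join N m phi s).
Proof.
have szu : (size (units m) <= m)%N by rewrite size_map size_iota.
apply: (rep_bind (G := fun ws phi => sd join phi (map s ws)) (rep_sdN K N szu)).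
by move=> ws _; apply: (rep_sd K (f := join) (Q := fun _ _ => True)).
Qed.

(** * Approximation of flags and its homotopy to the identity *)

Definition flag_simplex (s : seq {set I}) : smap d := aff (map (cell_pt h) s).

Definition approx N (psi : seq {set I} -> K) s : K :=
  label_sd join N (size s) psi (fun t => v (flag_simplex s t)).

Lemma flag_simplex_face i s t : (i < size s)%N ->
  flag_simplex s (face i t) = flag_simplex (del i s) t.
Proof.
move=> lti; rewrite /flag_simplex aff_face ?size_map //.
by rewrite /del map_cat map_take map_drop.
Qed.

Lemma approx_dl N psi s : approx N (dl psi) s = dl (approx N psi) s.
Proof.
case: s => [|t s]; first by rewrite /approx label_sd0.
rewrite /approx label_sd_dl dl_sum; apply: eq_bigr => i _; congr (_ * _).
rewrite size_del //=; congr label_sd; apply: functional_extensionality => x.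
by rewrite flag_simplex_face.
Qed.

Lemma approx_nil N psi : approx N psi [::] = psi [::].
Proof. exact: label_sd0. Qed.

Lemma approxB N phi psi s :
  approx N (fun w => phi w - psi w) s = approx N phi s - approx N psi s.
Proof. exact: (rep_lin _ _ (repT_label _ _ _)). Qed.

(* Dual of the chain homotopy [s |-> t * (approx s - s - homotopy (boundary s))]
   with [t] the largest cell of the flag [s]. *)
Fixpoint homotopy_rec N n (psi : seq {set I} -> K) s : K :=
  if n isn't n'.+1 then 0 else
  if s isn't t :: _ then 0 else
  let psi' w := psi (t :: w) in
  approx N psi' s - psi' s - dl (homotopy_rec N n' psi') s.

Definition homotopy N psi s := homotopy_rec N (size s) psi s.

Lemma homotopy_cons N psi t s (psi' := fun w => psi (t :: w)) :
  homotopy N psi (t :: s) = approx N psi' (t :: s) - psi' (t :: s) -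
    dl (homotopy N psi') (t :: s).
Proof.
transitivity (approx N psi' (t :: s) - psi' (t :: s) -
  dl (homotopy_rec N (size s) psi') (t :: s)); first by [].
congr (_ - _); apply: eq_dl_on => u fu.
by have := size_face fu => -[->].
Qed.

(** Used twice: with trivial [P] and [Q] for linearity in [psi], and with flags in [A] for the
    support. *)
Lemma rep_homotopy N (P : seq {set I} -> Prop) (Q : seq {set I} -> seq {set I} -> Prop) :
  (forall t s, P (t :: s) ->
    rep (fun w => Q (t :: s) (t :: w)) (fun psi => approx N psi (t :: s))) ->
  (forall t s, P (t :: s) -> Q (t :: s) [:: t, t & s]) ->
  (forall t s u w, P (t :: s) -> is_face (t :: s) u ->
    P u /\ (Q u w -> Q (t :: s) (t :: w))) ->
  forall s, P s -> rep (Q s) (fun psi => homotopy N psi s).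
Proof.
move=> Qa Qt Qf s; have [n] := ubnP (size s).
elim: n s => // n IH [|t s] sn Ps; first exact: rep0.
apply: (rep_ext (F := fun psi => approx N (fun w => psi (t :: w)) (t :: s) -
  psi [:: t, t & s] - dl (homotopy N (fun w => psi (t :: w))) (t :: s))).
  by move=> psi; rewrite homotopy_cons.
apply: repB; first apply: repB.
- exact: (@rep_map _ _ _ (fun w => Q (t :: s) (t :: w)) _ (cons t) _ _ (Qa _ _ Ps)).
- by apply: rep_point; apply: Qt.
apply: (rep_bind (G := fun u psi => homotopy N (fun w => psi (t :: w)) u)
  (rep_dl K (t :: s))) => u fu.
have [Pu Qu] := Qf t s u [::] Ps fu.
have ru : rep (Q u) (fun psi => homotopy N psi u).
  by apply: IH => //; move: sn; rewrite (size_face fu).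
by apply: (@rep_map _ _ _ _ _ (cons t) _ _ ru) => w; have [] := Qf t s u w Ps fu.
Qed.

Lemma homotopyB N phi psi s :
  homotopy N (fun w => phi w - psi w) s = homotopy N phi s - homotopy N psi s.
Proof.
have r : rep (fun _ => True) (fun psi => homotopy N psi s).
  apply: (@rep_homotopy N (fun _ => True) (fun _ _ => True)) => // t u _.
  exact: repT_label.
exact: (rep_lin _ _ r).
Qed.

(** The boundary of a cone [t * x] is [x] minus the cone over the boundary of [x]; by induction the
    chain that is coned here is a cycle. *)
Lemma homotopy_dl N psi s :
  homotopy N (dl psi) s = approx N psi s - psi s - dl (homotopy N psi) s.
Proof.
have [n] := ubnP (size s); elim: n psi s => // n IH psi [|t s] sn.
  by rewrite approx_nil subrr subr0.
rewrite homotopy_cons; set psi' := fun w => psi (t :: w).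
have -> : (fun w => dl psi (t :: w)) = (fun w => psi w - dl psi' w) by [].
rewrite approxB approx_dl.
rewrite (eq_dl_on (phi := homotopy N (fun w => psi w - dl psi' w)) (psi := fun u => homotopy N psi u -
    (approx N psi' u - psi' u - dl (homotopy N psi') u))) => [|u fu].
  rewrite !dlB (dl_dl (homotopy N psi')).
  by rewrite -[dl psi [:: t, t & s]]/(psi (t :: s) - dl psi' (t :: s)); ring.
rewrite homotopyB IH //.
by move: sn; rewrite (size_face fu).
Qed.

Lemma label_respects N n (psi : seq {set I} -> K) :
  respects n (fun s : smap d => label_sd join N n.+1 psi (fun t => v (s t))).
Proof.
move=> s s' ss'.
have szu : (size (units n.+1) <= n.+1)%N by rewrite size_map size_iota.
apply: (rep_eq_on (rep_sdN K N szu)) => ws [_ Wws _]; congr sd.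
have stdw x : List.In x ws -> std_simplex n x.
  by move=> xw; apply: (Wws _ (@std_simplex_bary n) _ x xw) => y; apply: units_std.
elim: ws stdw {Wws} => //= t ws IH stdw; rewrite ss'; last by apply: stdw; left.
by rewrite IH // => x xw; apply: stdw; right.
Qed.

(** The last condition keeps all cells inside the top cell of [s], so that coning with this cell
    gives a weak flag again. *)
Definition approx_in A N (s : seq {set I}) := rep
  (fun w => [/\ size w = size s, weak_flag h w, cells_in h A w
    & all (fun c : {set I} => c \subset head set0 s) w])
  (fun psi => approx N psi s).

Lemma flag_simplex_in A t s x : cell_closed h A -> flags_in h A (t :: s) ->
  std_simplex (size s) x ->
  A (flag_simplex (t :: s) x) /\ pos h (flag_simplex (t :: s) x) \subset t.
Proof.
move=> cA /andP[/andP[st rs] As] xs.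
have st_sub : pos h (flag_simplex (t :: s) x) \subset t.
  apply/subsetP => i; rewrite inE => hi; apply: contraLR hi => nti.
  rewrite -leNgt; apply: (hval_aff_le0 (n := size s)) => //.
    by rewrite /= size_map.
  move=> p ps; have [c cs ->] := @In_map_mem _ _ (cell_pt h) (t :: s) p ps.
  have : i \notin pos h (cell_pt h c).
    have ct : c \subset t.
      by apply: (@top_subset _ _ h _ s) cs; rewrite /weak_flag strict_weak.
    by rewrite pos_cell_pt ?(allP rs) //; apply: contra nti; apply: (subsetP ct).
  by rewrite inE -leNgt.
split=> //; have At : A (cell_pt h t) by case/andP: As => /asboolP.
by apply: cA At _; rewrite pos_cell_pt //; case/andP: rs.
Qed.

Lemma approx_in_eventually A s : cell_closed h A -> flags_in h A s ->
  eventually (fun N => approx_in A N s).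
Proof.
case: s => [|t s] cA Fs.
  exists 0%N => N _; apply: (rep_ext (F := fun psi => psi [::])) => [psi|].
    by rewrite approx_nil.
  exact: rep_point.
(* Intersecting [A] with the closure of the cell [t] makes [rep_label] yield the bound by the top
   cell as well. *)
pose A' y := A y /\ pos h y \subset t.
have cA' : cell_closed h A'.
  move=> x y [Ax xt] yx; split; first exact: cA Ax yx.
  exact: subset_trans yx xt.
have sA' : sing_simplex A' (size s) (flag_simplex (t :: s)).
  by apply: sing_simplex_aff => [|x xs]; rewrite ?size_map //; apply: flag_simplex_in.
apply: eventuallyW (rep_label cA' sA') => N; apply: rep_impl => w [sw ww Aw].
split=> //; apply/allP => c cw; have /asboolP[Ac ct] := allP Aw c cw.
  exact/asboolP.
by move: ct; rewrite pos_cell_pt //; case/andP: ww => _ /allP; apply.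
Qed.

Lemma eventually_fin (T : finType) (P : T -> nat -> Prop) :
  (forall x, eventually (P x)) -> eventually (fun N => forall x, P x N).
Proof.
move=> hP; have : eventually (fun N => forall x, List.In x (enum T) -> P x N).
  by apply: eventually_In.
apply: eventuallyW => N hN x; apply: hN; have := mem_enum T x.
rewrite inE; elim: (enum T) => //= a l IH.
by rewrite in_cons => /predU1P[->|/IH]; [left|right].
Qed.

(** There are finitely many flags of bounded size, and the homotopy needs one [N] for a flag and all
    its faces. *)
Lemma approx_in_uniform A n : cell_closed h A ->
  eventually (fun N => forall s, (size s <= n)%N -> flags_in h A s -> approx_in A N s).
Proof.
move=> cA; have : eventually (fun N => forall k : 'I_n.+1,
    forall s : k.-tuple {set I}, flags_in h A s -> approx_in A N s).
  apply: eventually_fin => k; apply: eventually_fin => s.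
  have [Fs|nF] := boolP (flags_in h A s).
    by apply: eventuallyW (approx_in_eventually cA Fs) => N.
  by exists 0%N.
by apply: eventuallyW => N hN s sn; apply: (hN (Ordinal (sn : (size s < n.+1)%N)) (in_tuple s)).
Qed.

Lemma homotopy_in A N n : cell_closed h A ->
  (forall s, (size s <= n)%N -> flags_in h A s -> approx_in A N s) ->
  forall s, (size s <= n)%N -> flags_in h A s ->
  rep (fun w => [/\ size w = (size s).+1, weak_flag h w & cells_in h A w])
    (fun psi => homotopy N psi s).
Proof.
move=> cA hN s sn Fs.
pose P u := (size u <= n)%N /\ flags_in h A u.
pose Q u w := [/\ size w = (size u).+1, weak_flag h w, cells_in h A w
    & all (fun c : {set I} => c \subset head set0 u) w].
suff : rep (Q s) (fun psi => homotopy N psi s) by apply: rep_impl => w [].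
apply: (rep_homotopy (P := P)) => // {sn Fs}s.
- move=> u [sn Fs]; apply: rep_impl (hN _ sn Fs) => w [sw /andP[ww rw] Aw hw].
  case/andP: Fs => /andP[_ /andP[rs _]] /andP[As _].
  split; rewrite /= ?sw ?subxx //; last by rewrite As.
  rewrite /weak_flag /= rs rw !andbT (path_sortedE (@supset_trans I)).
  by apply/andP.
- move=> u [sn /andP[/andP[st rs] As]].
  have ww : weak_flag h (s :: u) by rewrite /weak_flag strict_weak.
  split=> //.
  + case/andP: ww => /= pw _; rewrite /weak_flag /= pw /supset subxx.
    by move: rs => /= /andP[-> ->].
  + by move: As; rewrite /cells_in /= => /andP[-> ->].
  + by apply/allP => c; rewrite in_cons => /predU1P[->|]; rewrite ?subxx //; apply: top_subset ww.
- move=> u w w' [sn Fs] fw; have sw := size_face fw; split.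
    split; first by rewrite sw in sn; apply: ltnW.
    exact: (flags_in_complex h A).2 fw Fs.
  move=> [sw' /andP[ww' rw'] Aw' hw'].
  case/andP: (Fs) => /andP[st rs] As.
  have hws : all (fun c : {set I} => c \subset s) w'.
    apply: sub_all hw' => c cw; apply: subset_trans cw _.
    case: w fw {sw sw'} => [|c' w] fw; first exact: sub0set.
    apply: (@top_subset _ _ h _ u); first by rewrite /weak_flag strict_weak.
    by apply: mem_face fw (mem_head _ _).
  split; rewrite /= ?sw' -?sw ?subxx //; last by move: As => /= /andP[->].
  move: rs => /= /andP[rs _]; rewrite /weak_flag /= rs rw' !andbT.
  by rewrite (path_sortedE (@supset_trans I)); apply/andP.
Qed.

(** [F] differs from its approximation by the boundary of [D], and the approximation of the singular
    boundary of [b] is the boundary of [B]; so [B - D] bounds [F], up to degenerate sequences. *)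
Lemma flags_comparison A n F b : cell_closed h A ->
  rep (fun s => size s = n.+1 /\ flags_in h A s) F ->
  (forall phi, F (dl phi) = 0) -> chain_in A n.+1 b ->
  (forall f, respects n f -> F (fun s => f (flag_simplex s)) =
    ev b (fun s => \sum_(i < n.+2) (-1) ^+ i * f (fun t => s (face i t)))) ->
  exists2 G, rep (fun s => size s = n.+2 /\ flags_in h A s) G &
    forall phi : seq {set I} -> K, F phi = G (dl phi).
Proof.
move=> cA rF F0 bA bF.
have := eventually_and (approx_in_uniform n.+1 cA)
  (eventually_In (fun p pb => rep_label cA (bA p pb))).
move=> [N /(_ N (leqnn N)) [hN bN]].
pose B psi := ev b (fun s => label_sd join N n.+2 psi (fun t => v (s t))).
pose weak_in w := [/\ size w = n.+2, weak_flag h w & cells_in h A w].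
have rB : rep weak_in B.
  apply: (rep_ext (F := fun psi => \sum_(p <- b) p.1 *
    label_sd join N n.+2 psi (fun t => v (p.2 t)))) => //.
  elim: b bN {bA bF B} => [|p b IH] bN.
    by apply: (rep_ext (F := fun=> 0)) => [psi|]; [rewrite big_nil | apply: rep0].
  apply: (rep_ext (F := fun psi =>
    p.1 * label_sd join N n.+2 psi (fun t => v (p.2 t)) +
    \sum_(q <- b) q.1 * label_sd join N n.+2 psi (fun t => v (q.2 t)))).
    by move=> psi; rewrite big_cons.
  apply: repD; first by apply/repZ/bN; left.
  by apply: IH => q qb; apply: bN; right.
pose D psi := F (homotopy N psi).
have rD : rep weak_in D.
  apply: (rep_bind (G := fun s psi => homotopy N psi s) rF) => s [sn Fs].
  by apply: rep_impl (homotopy_in cA hN _ Fs) => [w|]; rewrite sn.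
(* Sequences with repetitions are dropped; [dl_on_strict] says that this commutes with the boundary
   on weak flags. *)
exists (fun phi => B (on (@strict I) phi) - D (on (@strict I) phi)).
  apply: (rep_ext (F := fun phi => (fun psi => B psi - D psi) (on (@strict I) phi))) => //.
  apply: rep_impl (rep_on (@strict I) (repB rB rD)) => w [[sw /andP[_ rw] Aw] stw].
  by rewrite /flags_in /flag stw rw.
move=> phi; have strictE psi w : weak_in w ->
    dl (on (@strict I) psi) w = on (@strict I) (dl psi) w.
  by move=> [_ /andP[ww _] _]; apply: dl_on_strict.
set psi := on (@strict I) phi.
have -> : F phi = F psi.
  by apply: (rep_eq_on rF) => s [_ /andP[/andP[st _] _]]; rewrite /psi /on st.
have -> : F psi = F (fun s => approx N psi s - dl (homotopy N psi) s) - D (dl psi).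
  rewrite -(rep_lin _ _ rF); apply: (rep_eq_on rF) => s _.
  by rewrite homotopy_dl; ring.
rewrite (rep_lin _ _ rF) F0 subr0; congr (_ - _); last first.
  by apply: (rep_eq_on rD) => w win; rewrite strictE.
have <- : B (dl psi) = B (on (@strict I) (dl phi)).
  by apply: (rep_eq_on rB) => w win; rewrite strictE.
have -> : F (approx N psi) = F (fun s =>
    label_sd join N n.+1 psi (fun t => v (flag_simplex s t))).
  by apply: (rep_eq_on rF) => s [sn _]; rewrite /approx sn.
rewrite (bF _ (label_respects N psi)); apply: eq_ev => s.
by rewrite label_sd_dl.
Qed.

End Comparison.

(** * Approximation by cells, dimension of flags *)

Section Arrangement.
Variables (K : fieldType) (d : nat) (I : finType) (h : I -> pt d * R).
Implicit Types (x y : pt d) (Z c : {set I}).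

Lemma hvalB (g : pt d * R) x y :
  hval g x - hval g y = \sum_j g.1 j * (x j - y j).
Proof.
rewrite /hval opprD addrACA subrr addr0 -sumrB.
by apply: eq_bigr => j _; rewrite mulrBr.
Qed.

Lemma hval_lipschitz : exists2 L, 0 <= L & forall i (D : R) x y,
  (forall j, `|x j - y j| <= D) -> `|hval (h i) x - hval (h i) y| <= L * D.
Proof.
exists (\sum_i \sum_j `|(h i).1 j|); first by rewrite !sumr_ge0 // => i _; rewrite sumr_ge0.
move=> i D x y xy; apply: (@le_trans _ _ ((\sum_j `|(h i).1 j|) * D)).
  rewrite hvalB mulr_suml; apply: le_trans (ler_norm_sum _ _ _) _.
  by apply: ler_sum => j _; rewrite normrM ler_wpM2l.
have [j _|noj] := pickP (fun _ : 'I_d => true).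
  have D0 : 0 <= D by apply: le_trans (normr_ge0 _) (xy j).
  rewrite ler_wpM2r // (bigD1 i) //= lerDl sumr_ge0 // => k _.
  by rewrite sumr_ge0.
have s0 k : \sum_j `|(h k).1 j| = 0 by rewrite big1 // => j; have := noj j.
by rewrite s0 (big1 _ _ _ (fun k _ => s0 k)).
Qed.

(* If the hyperplanes indexed by [Z] have no common point, a linear relation
   between them bounds [max_Z |h_i|] from below; otherwise a right inverse of
   their linear part moves [y] onto the intersection. *)
Lemma near_intersection Z : exists2 C, 0 <= C & forall D y, D * C < 1 ->
  (forall i, i \in Z -> `|hval (h i) y| <= D) ->
  exists2 y', forall i, i \in Z -> hval (h i) y' = 0 &
    forall j, `|y' j - y j| <= C * D.
Proof.
pose H : 'M[R]_(d, #|I|) :=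
  \matrix_(j, k) (if enum_val k \in Z then (h (enum_val k)).1 j else 0).
pose beta : 'rV[R]_#|I| :=
  \row_k (if enum_val k \in Z then (h (enum_val k)).2 else 0).
pose u y : 'rV[R]_#|I| := (\row_j y j) *m H + beta.
have uE y k : u y 0 k = if enum_val k \in Z then hval (h (enum_val k)) y else 0.
  rewrite !mxE; case: ifP => kZ.
    rewrite /hval; congr (_ + _); apply: eq_bigr => j _.
    by rewrite !mxE kZ mulrC.
  by rewrite addr0 big1 // => j _; rewrite !mxE kZ mulr0.
have u_le D y : 0 <= D -> (forall i, i \in Z -> `|hval (h i) y| <= D) ->
    forall k, `|u y 0 k| <= D.
  by move=> D0 hD k; rewrite uE; case: ifP => [/hD//|_]; rewrite normr0.
have mul_le m D y (P : 'M[R]_(#|I|, m)) : 0 <= D ->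
    (forall i, i \in Z -> `|hval (h i) y| <= D) ->
    forall j, `|(u y *m P) 0 j| <= D * \sum_k \sum_l `|P k l|.
  move=> D0 hD j; rewrite mxE; apply: le_trans (ler_norm_sum _ _ _) _.
  rewrite mulr_sumr; apply: ler_sum => k _; rewrite normrM.
  apply: ler_pM => //; first exact: u_le.
  by rewrite (bigD1 j) //= lerDl sumr_ge0.
have D_ge0 D y : Z != set0 -> (forall i, i \in Z -> `|hval (h i) y| <= D) -> 0 <= D.
  by move=> /set0Pn[i iZ] /(_ i iZ); apply: le_trans.
have [->|Z0] := eqVneq Z set0.
  exists 0 => // D y _ _; exists y => [i|j]; first by rewrite inE.
  by rewrite subrr normr0 mul0r.
have [bH|nbH] := boolP (beta <= H)%MS.
  exists (\sum_k \sum_l `|pinvmx H k l|).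
    by rewrite !sumr_ge0 // => k _; rewrite sumr_ge0.
  move=> D y _ hD; have D0 := D_ge0 _ _ Z0 hD.
  pose w := u y *m pinvmx H.
  have wH : w *m H = u y.
    by rewrite mulmxKpV // addmx_sub // submxMl.
  exists (fun j => y j - w 0 j)%R => [i iZ|j]; last first.
    by rewrite addrAC subrr sub0r normrN mulrC; apply: mul_le.
  have yE : (\row_j (y j - w 0 j)) = (\row_j y j) - w.
    by apply/rowP => j; rewrite !mxE.
  have := uE (fun j => y j - w 0 j)%R (enum_rank i); rewrite enum_rankK iZ => <-.
  by rewrite /u yE mulmxBl wH addrAC subrr mxE.
(* A column of [cokermx H] is the linear relation: it kills the linear parts, so its value [gam] on
   [u y] does not depend on [y]. *)
have /rV0Pn[l nzl] : beta *m cokermx H != 0 by rewrite -submxE.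
set gam := _ 0 l in nzl.
have uc y : (u y *m cokermx H) 0 l = gam.
  by rewrite /u mulmxDl -mulmxA mulmx_coker mulmx0 add0r.
have gam0 : 0 < `|gam| by rewrite normr_gt0.
set S := \sum_k \sum_l0 `|cokermx H k l0|.
have S0 : 0 <= S by rewrite !sumr_ge0 // => k _; rewrite sumr_ge0.
exists (S / `|gam|); first by rewrite divr_ge0.
move=> D y DC hD; have D0 := D_ge0 _ _ Z0 hD.
have := mul_le _ _ _ (cokermx H) D0 hD l; rewrite uc -/S.
move=> gam_le; suff : `|gam| < `|gam| by rewrite ltxx.
by apply: le_lt_trans gam_le _; move: DC; rewrite mulrA ltr_pdivrMr // mul1r.
Qed.

Lemma near_intersections : exists2 C, 0 <= C & forall Z D y, D * C < 1 ->
  0 <= D -> (forall i, i \in Z -> `|hval (h i) y| <= D) ->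
  exists2 y', forall i, i \in Z -> hval (h i) y' = 0 &
    forall j, `|y' j - y j| <= C * D.
Proof.
have /choice[C hC] : forall Z, exists C, 0 <= C /\ forall D y, D * C < 1 ->
    (forall i, i \in Z -> `|hval (h i) y| <= D) ->
    exists2 y', forall i, i \in Z -> hval (h i) y' = 0 &
      forall j, `|y' j - y j| <= C * D.
  by move=> Z; have [C C0 CP] := near_intersection Z; exists C.
have leC Z : C Z <= \sum_Z' C Z'.
  by rewrite (bigD1 Z) //= lerDl sumr_ge0 // => Z' _; case: (hC Z').
exists (\sum_Z C Z); first by rewrite sumr_ge0 // => Z _; case: (hC Z).
move=> Z D y DC D0 hD; have [C0 hZ] := hC Z.
have [|y' y'Z y'y] := hZ D y _ hD.
  by apply: le_lt_trans DC; rewrite ler_wpM2l.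
by exists y' => // j; apply: le_trans (y'y j) _; rewrite ler_wpM2r.
Qed.

(* Values [|h_i y|] are rounded to 0 below one of the scales [delta j], chosen
   such that no [|h_i y|] lies between two consecutive scales. *)
Lemma cell_approximation : exists (eps : R) (v : pt d -> {set I}),
  [/\ 0 < eps, forall y, realizable h (v y), forall y, v y \subset pos h y
    & forall y y', (forall j, `|y j - y' j| < eps) ->
      (v y \subset v y') || (v y' \subset v y)].
Proof.
have [L L0 hL] := hval_lipschitz; have [C C0 hC] := near_intersections.
(* [r <= 1/2] separates the scales. [L * C * r < 1] ensures that the move onto the intersection, by
   at most [C * delta j.+1], changes every form by less than [delta j]. *)
have [r [r0 r2 rLC]] : exists r : R, [/\ 0 < r, r * 2 <= 1 & L * C * r < 1].
  have LC0 : 0 <= L * C by rewrite mulr_ge0.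
  have k0 : 0 < L * C + 2 by lra.
  exists ((L * C + 2)^-1); rewrite invr_gt0 k0; split=> //.
    by rewrite mulrC ler_pdivrMr //; lra.
  by rewrite ltr_pdivrMr //; lra.
pose delta j := (C + 1)^-1 * r ^+ j.
have delta_gt0 j : 0 < delta j.
  by rewrite mulr_gt0 ?exprn_gt0 ?invr_gt0 //; lra.
have deltaS j : delta j.+1 = delta j * r by rewrite /delta exprSr mulrA.
have delta2 j : delta j.+1 * 2 <= delta j.
  by rewrite deltaS; have := delta_gt0 j; nra.
have delta_le j k : (j <= k)%N -> delta k <= delta j.
  elim: k => [|k IH]; first by rewrite leqn0 => /eqP ->.
  rewrite leq_eqVlt => /predU1P[->//|/IH]; apply: le_trans.
  by have := delta2 k; have := delta_gt0 k.+1; lra.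
have deltaC j : delta j * C < 1.
  apply: le_lt_trans (_ : delta 0%N * C < 1).
    by rewrite ler_wpM2r ?delta_le.
  by rewrite /delta expr0 mulr1 mulrC ltr_pdivrMr; lra.
pose gap y j := forall i, `|hval (h i) y| < delta j -> `|hval (h i) y| < delta j.+1.
have ex_gap y : exists j, (j <= #|I|)%N /\ gap y j.
  (* Without a gap, [#|I|.+1] disjoint intervals would each contain a value of one of [#|I|]
     forms. *)
  apply: contrapT => nogap.
  have /choice[f hf] : forall j : 'I_#|I|.+1, exists i,
      delta j.+1 <= `|hval (h i) y| < delta j.
    move=> j; apply: contrapT => noi; apply: nogap; exists j; split; first by rewrite -ltnS.
    by move=> i lti; rewrite ltNge; apply/negP => lei; apply: noi; exists i; rewrite lei.
  have f_lt (j k : 'I_#|I|.+1) : (j < k)%N -> f j != f k.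
    move=> jk; apply/eqP => fjk; have /andP[hj _] := hf j; have /andP[_ hk] := hf k.
    rewrite fjk in hj; have := delta_le _ _ jk; lra.
  have f_inj : injective f.
    move=> j k fjk; apply/val_inj; case: (ltngtP j k) => // jk.
      by have := f_lt _ _ jk; rewrite fjk eqxx.
    by have := f_lt _ _ jk; rewrite fjk eqxx.
  by have := leq_card f f_inj; rewrite card_ord ltnn.
have /choice[lev hlev] := ex_gap.
pose v y := [set i | delta (lev y) <= hval (h i) y].
pose e := delta #|I|.+1 / (L + 1).
have e0 : 0 < e by rewrite divr_gt0 //; lra.
have Le : L * e <= delta #|I|.+1.
  rewrite /e mulrA ler_pdivrMr; last lra.
  by have := delta_gt0 #|I|.+1; nra.
exists e, v; split=> // [y|y|y y'].
- apply/asboolP; set j := lev y; have [_ gapj] := hlev y.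
  pose Z := [set i | `|hval (h i) y| < delta j.+1].
  have [||i|y' y'Z y'y] := hC Z (delta j.+1) y; rewrite ?deltaC ?inE //.
  + exact: ltW.
  + exact: ltW.
  have hy' i : `|hval (h i) y' - hval (h i) y| < delta j.
    apply: le_lt_trans (hL i _ _ _ y'y) _; rewrite deltaS.
    rewrite (_ : L * _ = delta j * (L * C * r)); last by ring.
    by rewrite -[ltRHS]mulr1 ltr_pM2l.
  exists y'; apply/setP => i; rewrite !inE -/j.
  have [iZ|niZ] := boolP (i \in Z).
    rewrite y'Z // ltxx; apply/esym/negbTE; rewrite -ltNge.
    move: iZ; rewrite inE => iZ; apply: le_lt_trans (ler_norm _) _.
    by apply: lt_le_trans iZ _; apply: delta_le.
  have : delta j <= `|hval (h i) y|.
    by rewrite leNgt; apply: contra niZ => /gapj; rewrite inE.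
  have := hy' i; have := delta_gt0 j; rewrite ltr_norml ler_normr.
  move=> dj /andP[h1 h2] /orP[h3|h3].
    by rewrite h3; lra.
  by apply/idP/idP; lra.
- apply/subsetP => i; rewrite !inE; exact: lt_le_trans.
move=> yy'; wlog le_lev : y y' yy' / (lev y <= lev y')%N.
  move=> W; case: (leqP (lev y) (lev y')) => [|/ltnW] /W; first exact.
  by rewrite orbC; apply => j; rewrite distrC.
(* A form kept at [y] is at least [delta (lev y).+1] at [y'], because [e] is small against the
   finest scale; the gap at [y'] then lifts it to the threshold of [y']. *)
apply/orP; left; apply/subsetP => i; rewrite !inE => hi.
have [levI gap'] := hlev y'.
have : `|hval (h i) y - hval (h i) y'| <= L * e by apply: hL => j; apply: ltW.
rewrite ler_norml => /andP[_ hyy'].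
have d1 : delta #|I|.+1 <= delta (lev y).+1.
  by apply: delta_le; rewrite ltnS (leq_trans le_lev).
have d2 : delta (lev y').+1 <= delta (lev y).+1 by apply: delta_le.
have d3 := delta2 (lev y).
have hi' : delta (lev y').+1 <= hval (h i) y' by lra.
have pos_hi : 0 < hval (h i) y' by apply: lt_le_trans hi'.
have := gap' i; rewrite gtr0_norm //; case: ltP => // _ /(_ isT); lra.
Qed.

Hypothesis h_opp : forall i, exists i', forall x, hval (h i') x = - hval (h i) x.

(** The rank of this matrix is the codimension of the cell [c]. *)
Definition zero_rows c : 'M[R]_(#|I|, d) := \matrix_(k, j)
  (if hval (h (enum_val k)) (cell_pt h c) == 0 then (h (enum_val k)).1 j else 0).

(** Forms vanishing on [s] vanish on [t]. With equal ranks the row spaces would agree, so [xs - xt],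
    killed by the rows of [s], would be killed by those of [t]; but the form [i] is positive at [xs]
    and 0 at [xt]. *)
Lemma zero_rows_rank (s t : {set I}) : realizable h s -> realizable h t ->
  t \proper s -> (\rank (zero_rows s) < \rank (zero_rows t))%N.
Proof.
move=> rs rt /properP[ts [i is_ it]].
set xs := cell_pt h s; set xt := cell_pt h t.
have ps : pos h xs = s := pos_cell_pt rs.
have pt_ : pos h xt = t := pos_cell_pt rt.
have le0 k : hval (h k) xs <= 0 -> hval (h k) xt <= 0.
  rewrite !leNgt; apply: contra; have := subsetP ts k.
  by rewrite -[in k \in t]pt_ -[in k \in s]ps !inE.
have ge0 k : 0 <= hval (h k) xs -> 0 <= hval (h k) xt.
  have [k' kE] := h_opp k => hk; have := le0 k'; rewrite !kE !oppr_le0; exact.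
have eq0 k : hval (h k) xs = 0 -> hval (h k) xt = 0.
  move=> e0; apply/eqP; rewrite eq_le le0 ?ge0 //; by rewrite e0.
have hi : 0 < hval (h i) xs by move: is_; rewrite -ps inE.
have hi0 : hval (h i) xt = 0.
  apply/eqP; rewrite eq_le ge0 ?andbT; last exact: ltW.
  by move: it; rewrite -pt_ inE -leNgt.
have sub : (zero_rows s <= zero_rows t)%MS.
  apply/row_subP => k; have [e0|n0] := eqVneq (hval (h (enum_val k)) xs) 0.
    have -> : row k (zero_rows s) = row k (zero_rows t); last exact: row_sub.
    by apply/rowP => j; rewrite !mxE -/xs -/xt e0 eq0 // eqxx.
  have -> : row k (zero_rows s) = 0; last exact: sub0mx.
  by apply/rowP => j; rewrite !mxE -/xs (negbTE n0).
rewrite ltn_neqAle (mxrankS sub) andbT; apply/negP => /eqP eqr.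
have /submxP[P PE] : (zero_rows t <= zero_rows s)%MS.
  by rewrite -(mxrank_leqif_sup sub).2 eqr.
pose w : 'cV[R]_d := \col_j (xs j - xt j).
have mulE c k : (zero_rows c *m w) k 0 =
    if hval (h (enum_val k)) (cell_pt h c) == 0
    then hval (h (enum_val k)) xs - hval (h (enum_val k)) xt else 0.
  rewrite mxE; case: ifP => e.
    by rewrite hvalB; apply: eq_bigr => j _; rewrite !mxE e.
  by rewrite big1 // => j _; rewrite !mxE e mul0r.
have sw : zero_rows s *m w = 0.
  apply/colP => k; rewrite mulE mxE; case: eqP => // e0.
  by rewrite -/xs e0 eq0 // subrr.
have := mulE t (enum_rank i); rewrite enum_rankK -/xt hi0 eqxx subr0.
by rewrite PE -mulmxA sw mulmx0 mxE => e; rewrite -e ltxx in hi.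
Qed.

Lemma size_flag s : flag h s -> (size s <= d.+1)%N.
Proof.
case: s => // c s /andP[st /andP[rc rs]] /=; rewrite ltnS.
apply: (@leq_trans (\rank (zero_rows c) + size s)); first exact: leq_addl.
elim: s c rc st rs => [|c' s IH] c rc /=; first by rewrite addn0 rank_leq_col.
move=> /andP[cc' st] /andP[rc' rs]; rewrite -addSnnS.
apply: leq_trans (IH c' rc' st rs); rewrite leq_add2r.
exact: zero_rows_rank.
Qed.

End Arrangement.

(** * Acyclicity in high degrees, Fourier-Motzkin elimination *)

Section ArrangementAcyclicity.
Variables (K : fieldType) (d : nat) (I : finType) (h : I -> pt d * R).
Hypothesis h_opp : forall i, exists i', forall x, hval (h i') x = - hval (h i) x.

Lemma rep_flag0 (A : rset d) N F : (d.+1 < N)%N ->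
  rep (fun s => size s = N /\ flags_in h A s) F ->
  forall phi : seq {set I} -> K, F phi = 0.
Proof.
move=> dN rF phi; apply: (rep_eq0 rF) => s [sN /andP[fs _]].
by have := size_flag h_opp fs; rewrite sN leqNgt dN.
Qed.

(** For [N = d.+1] the singular cone from the origin bounds the cycle, so the cycle bounds flags of
    [d.+2] cells, and there are none. For larger [N] there are no flags to start with. *)
Lemma high_acyclic (Y : seq {set I} -> bool) N : complex Y ->
  (forall s, Y s -> flags_in h (fun _ => True) s) ->
  (d < N)%N -> acyclic K N Y.
Proof.
move=> cY Yflag; rewrite leq_eqVlt => /predU1P[<-|dN] F rF F0; last first.
  exists (fun=> 0); first exact: rep0.
  move=> phi; apply: (@rep_flag0 (fun _ => True) N F dN).
  by apply: rep_impl rF => s [-> /Yflag].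
have {Yflag cY}rF' : rep (fun s => size s = d.+1 /\ flags_in h (fun _ => True) s) F.
  by apply: rep_impl rF => s [-> /Yflag].
suff Fz phi : F phi = 0 by exists (fun=> 0) => //; exact: rep0.
have [eps [v [e0 vr vp vc]]] := cell_approximation h.
have [c [cs FE]] := rF'.
pose b : chain K d := [seq (p.1, aff ((fun=> 0%R) :: map (cell_pt h) p.2)) | p <- c].
have [| |f rf|G rG ->] :=
  @flags_comparison K d I h eps v e0 vr vp vc (fun _ => True) d F b _ rF' F0.
- by [].
- move=> p pb; have [q [Ep qc]] := proj1 (List.in_map_iff _ _ _) pb.
  have [sq _] := cs q qc; rewrite -Ep; apply: sing_simplex_aff => //.
  by rewrite /= size_map sq.
- rewrite /b (ev_map (fun s => aff ((fun=> 0%R) :: map (cell_pt h) s))) FE.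
  apply/eqP; rewrite -subr_eq0 -evB; apply/eqP.
  (* What the boundary of the cone has besides its base is the cone over the boundary of [F], which
     is zero. *)
  transitivity (F (dl (fun u => f (aff ((fun=> 0%R) :: map (cell_pt h) u)))));
    last by rewrite F0.
  rewrite FE; apply: (eq_ev_supp cs) => s [ss _].
  set ps := map (cell_pt h) s.
  have -> : \sum_(i < d.+2) (-1) ^+ i * f (fun t => aff ((fun=> 0%R) :: ps) (face i t))
      = dl (fun qs => f (aff qs)) ((fun=> 0%R) :: ps).
    have sps : size ((fun=> 0%R) :: ps) = d.+2 by rewrite /= size_map ss.
    rewrite dl_sum sps; apply: eq_bigr => i _; congr (_ * f _).
    apply: functional_extensionality => t; apply: aff_face.
    by rewrite sps.
  by rewrite /= dl_map subKr.
- by apply: (rep_flag0 _ rG).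
Qed.

End ArrangementAcyclicity.

(** * Convex hulls as intersections of half-spaces *)

Section FourierMotzkin.
Variable d : nat.
Implicit Types (g : pt d * R) (x p : pt d) (ps : seq (pt d)).

Definition lin g x (t : R) : R := (\sum_j g.1 j * x j + g.2 * t)%R.

Lemma lin_comb g g' x (t a b : R) :
  lin (fun j => a * g.1 j + b * g'.1 j, a * g.2 + b * g'.2)%R x t =
  a * lin g x t + b * lin g' x t.
Proof.
rewrite /lin /=; under eq_bigr do rewrite mulrDl -!mulrA.
by rewrite big_split /= -!mulr_sumr; ring.
Qed.

Lemma linB g x p (t l : R) :
  lin g (fun j => x j - l * p j)%R (t - l)%R = lin g x t - l * lin g p 1%R.
Proof.
rewrite /lin /=; under eq_bigr do rewrite mulrBr mulrCA.
by rewrite sumrB -mulr_sumr; ring.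
Qed.

(** Homogenisation: [t] is the total weight, so convex hulls are the slices [t = 1], and a single
    coefficient can be split off. *)
Definition in_cone ps x (t : R) := exists lam : seq R,
  [/\ size lam = size ps, forall l, List.In l lam -> 0 <= l, lsumR lam = t
    & forall j, x j = lsumR [seq (q.1 * q.2 j)%coqR | q <- zip lam ps]].

Lemma in_cone_cons p ps x t : in_cone (p :: ps) x t <->
  exists2 l, 0 <= l & in_cone ps (fun j => x j - l * p j)%R (t - l)%R.
Proof.
split=> [[[|l lam] [// [sl] lam0 lt lx]]|[l l0 [lam [sl lam0 lt lx]]]].
  exists l; first by apply: lam0; left.
  exists lam; split=> // [l' ll'||j]; first by apply: lam0; right.
    by rewrite -lt /= RplusE addrC addKr.
  by rewrite lx /= RplusE RmultE addrC addKr.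
exists (l :: lam); split=> [|l' /= [<-//|/lam0//]||j]; first by rewrite /= sl.
  by rewrite /= lt RplusE addrC subrK.
by rewrite /= -lx RplusE RmultE addrC subrK.
Qed.

Lemma max_In (s : seq R) (a : R) : exists2 l, List.In l (a :: s) &
  forall z, List.In z (a :: s) -> z <= l.
Proof.
elim: s a => [|b s IH] a; first by exists a => [|x /= [<-|//]]; [left|].
have [l ls lmax] := IH b; have [al|la] := leP a l.
  by exists l => [|x [<-//|/lmax//]]; right.
exists a => [|x [<-//|/lmax xl]]; first by left.
exact: le_trans xl (ltW la).
Qed.

(* Fourier-Motzkin elimination of the coefficient of the first generator. *)
Lemma cone_halfspaces ps : exists G : seq (pt d * R), forall x t,
  in_cone ps x t <-> forall g, List.In g G -> 0 <= lin g x t.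
Proof.
elim: ps => [|p ps [G hG]].
  pose e (j : 'I_d) : pt d := fun k => if k == j then 1%R else 0%R.
  pose ne (j : 'I_d) : pt d := fun k => if k == j then (-1)%R else 0%R.
  have lin_e j x t : lin (e j, 0%R) x t = x j.
    rewrite /lin /= mul0r addr0 (bigD1 j) //= /e eqxx mul1r big1 ?addr0 // => k.
    by move=> /negbTE ->; rewrite mul0r.
  have lin_ne j x t : lin (ne j, 0%R) x t = - x j.
    rewrite /lin /= mul0r addr0 (bigD1 j) //= /ne eqxx mulN1r big1 ?addr0 // => k.
    by move=> /negbTE ->; rewrite mul0r.
  have lin_t a x t : lin (fun=> 0%R, a) x t = a * t.
    by rewrite /lin /= big1 ?add0r // => j _; rewrite mul0r.
  exists ((fun=> 0%R, 1%R) :: (fun=> 0%R, (-1)%R) ::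
    List.flat_map (fun j => [:: (e j, 0%R); (ne j, 0%R)]) (enum 'I_d)) => x t.
  split=> [[lam [/size0nil -> _ <- lx]] g|h].
    move=> /= [<-|[<-|/List.in_flat_map[j [_ /= [<-|[<-|//]]]]]].
    - by rewrite lin_t mulr0.
    - by rewrite lin_t mulr0.
    - by rewrite lin_e lx.
    - by rewrite lin_ne lx oppr0.
  have in_enum (j : 'I_d) : List.In j (enum 'I_d).
    have : j \in enum 'I_d by rewrite mem_enum.
    elim: (enum _) => //= a l IH; rewrite in_cons.
    by move=> /predU1P[->|/IH]; [left|right].
  have h1 := h _ (or_introl erefl); have h2 := h _ (or_intror (or_introl erefl)).
  rewrite !lin_t in h1 h2.
  exists [::]; split=> //= [|j].
    suff -> : t = 0 by [].
    by apply/eqP; rewrite eq_le; apply/andP; split; lra.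
  have hj g : List.In g [:: (e j, 0%R); (ne j, 0%R)] -> 0 <= lin g x t.
    move=> gj; apply: h; right; right; apply/List.in_flat_map.
    by exists j; split.
  have := hj _ (or_introl erefl); have := hj _ (or_intror (or_introl erefl)).
  rewrite lin_e lin_ne => xj0 xj1.
  suff -> : x j = 0 by [].
  by apply/eqP; rewrite eq_le; apply/andP; split; lra.
pose q g := lin g p 1%R.
(* For the coefficient [l] of [p], the form [g] demands [l * q g <= lin g x t]: an upper bound if
   [q g > 0], a lower one if [q g < 0]. Each pair of opposite bounds gives one combined form. *)
exists (List.filter (fun g => 0 <= q g) G ++
  List.flat_map (fun g => List.map (fun g' =>
      (fun j => - q g' * g.1 j + q g * g'.1 j, - q g' * g.2 + q g * g'.2)%R)
    (List.filter (fun g' => q g' < 0) G)) (List.filter (fun g => 0 < q g) G)) => x t.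
rewrite in_cone_cons; split=> [[l l0 /hG hl] g|h].
  have {}hl g' : List.In g' G -> l * q g' <= lin g' x t.
    by move=> /hl; rewrite linB subr_ge0.
  move=> /List.in_app_iff[/List.filter_In[gG qg]|].
    by apply: le_trans (hl _ gG); rewrite mulr_ge0.
  move=> /List.in_flat_map[g1 [/List.filter_In[g1G q1]]].
  move=> /List.in_map_iff[g2 [<- /List.filter_In[g2G q2]]].
  rewrite lin_comb (_ : _ + _ = - q g2 * (lin g1 x t - l * q g1) +
    q g1 * (lin g2 x t - l * q g2)); last by ring.
  have q1' : 0 < q g1 := q1; have q2' : q g2 < 0 := q2.
  by rewrite addr_ge0 ?mulr_ge0 ?subr_ge0 ?hl ?oppr_ge0 // ltW.
have h1 g : List.In g G -> 0 <= q g -> 0 <= lin g x t.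
  by move=> gG qg; apply: h; apply/List.in_app_iff; left; apply/List.filter_In.
have h2 g g' : List.In g G -> List.In g' G -> 0 < q g -> q g' < 0 ->
    0 <= - q g' * lin g x t + q g * lin g' x t.
  move=> gG gG' qg qg'; rewrite -lin_comb; apply: h.
  apply/List.in_app_iff; right; apply/List.in_flat_map; exists g.
  split; first exact/List.filter_In.
  by apply/List.in_map_iff; exists g'; split=> //; apply/List.filter_In.
(* The least admissible coefficient: the largest of 0 and the lower bounds. *)
have [l ll lmax] := max_In
  (List.map (fun g => lin g x t / q g) (List.filter (fun g => q g < 0) G)) 0%R.
exists l; first by apply: lmax; left.
apply/hG => g gG; rewrite linB subr_ge0 -/(q g).
have [qg|qg|qg] := ltgtP (q g) 0.
- rewrite -ler_ndivrMr //; apply: lmax; right.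
  by apply/List.in_map_iff; exists g; split=> //; apply/List.filter_In.
- rewrite -ler_pdivlMr //; case: ll => [<-|].
    by rewrite divr_ge0 ?h1 // ltW.
  move=> /List.in_map_iff[g' [<- /List.filter_In[gG' qg']]].
  rewrite ler_pdivlMr // mulrAC ler_ndivrMr //.
  have := h2 _ _ gG gG' qg qg'; lra.
- by rewrite qg mulr0 h1 // qg.
Qed.

Lemma polyhedron_halfspaces (A : rset d) : polyhedron A ->
  exists G : seq (pt d * R), forall x y,
    (forall g, List.In g G -> 0 <= hval g x -> 0 <= hval g y) -> A x -> A y.
Proof.
move=> [Ps hA]; suff [G hG] : exists G : seq (pt d * R), forall x y,
    (forall g, List.In g G -> 0 <= hval g x -> 0 <= hval g y) ->
    forall ps, List.In ps Ps -> conv_hull ps x -> conv_hull ps y.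
  exists G => x y xy /hA[ps [psP cx]]; apply/hA; exists ps; split=> //.
  exact: hG xy _ psP cx.
have hullE ps x : conv_hull ps x <-> in_cone ps x 1%R.
  split=> -[lam]; first by move=> [sl [l0 [l1 lx]]]; exists lam; split=> // l /l0 /RleP.
  by move=> [sl l0 l1 lx]; exists lam; split=> //; split=> // l /l0 /RleP.
elim: {A hA} Ps => [|ps Ps [G hG]]; first by exists [::].
have [G' hG'] := cone_halfspaces ps; exists (G' ++ G) => x y xy ps' /= [<-|ps'P].
  have linE g z : lin g z 1%R = hval g z by rewrite /lin mulr1.
  rewrite !hullE !hG' => h g gG; rewrite linE; apply: xy.
    by apply/List.in_app_iff; left.
  by rewrite -linE; apply: h.
by apply: hG ps'P => g gG; apply: xy; apply/List.in_app_iff; right.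
Qed.

End FourierMotzkin.

(** * The theorem *)

(** The affine simplices of a cycle of flags form a singular cycle in [A]; a singular chain bounding
    it feeds [flags_comparison]. *)
Lemma singular_acyclic_flags (K : fieldType) (d : nat) (I : finType)
    (h : I -> pt d * R) (A : rset d) N :
  cell_closed h A -> Hred_zero K A (Posz N - 1)%R -> acyclic K N (flags_in h A).
Proof.
move=> cA; case: N => [|n].
  move=> [x Ax] F rF F0; have px := realizable_pos h x.
  exists (fun phi => F (fun=> phi [:: pos h x])).
    apply: (rep_bind (G := fun _ phi => phi [:: pos h x]) rF) => s _.
    apply: rep_point; split; rewrite // /flags_in /flag /cells_in /= px !andbT.
    by apply/asboolP; apply: cA Ax _; rewrite pos_cell_pt.
  by move=> phi; apply: (rep_eq_on rF) => s [/size0nil -> _] /=; rewrite subr0.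
rewrite (_ : (Posz n.+1 - 1)%R = Posz n); last by lia.
move=> Hn F rF F0; have [c [cs FE]] := rF.
pose z : chain K d := [seq (p.1, flag_simplex h p.2) | p <- c].
have zE f : ev z f = F (fun s => f (flag_simplex h s)).
  by rewrite FE; apply: (ev_map (flag_simplex h)).
have [||b [bA zb]] := Hn z.
- move=> p pz; have [q [<- qc]] := proj1 (List.in_map_iff _ _ _) pz.
  have [sq fq] := cs q qc; apply: sing_simplex_aff => [|t tS].
    by rewrite size_map sq.
  case E: q.2 sq fq => [|c0 s] //= [sq] fq.
  by rewrite -sq in tS; have [] := flag_simplex_in cA fq tS.
(* In degree 0 the cycle condition is a zero coefficient sum, which is the augmentation
   [F (dl (fun=> 1))]. *)
- case En: n => [|n'].
    transitivity (ev z (fun=> 1)).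
      by apply: eq_bigr => p _; rewrite mulr1.
    rewrite zE -(F0 (fun=> 1)); apply: (rep_eq_on rF) => s [].
    by rewrite En; case: s => [|c0 []] //= _ _; rewrite subr0.
  move=> s; rewrite coefE ev_bd zE.
  pose f u := if same_simplex n' (flag_simplex h u) s then 1 else 0 : K.
  rewrite -[RHS](F0 f); apply: (rep_eq_on rF) => u [su _].
  rewrite dl_sum su En; apply: eq_bigr => i _; congr (_ * _); rewrite /f.
  congr (if same_simplex _ _ _ then _ else _); apply: functional_extensionality => t.
  by rewrite flag_simplex_face // su En.
have [eps [v [e0 vr vp vc]]] := cell_approximation h.
apply: (flags_comparison e0 vr vp vc cA rF F0 bA) => f rf.
have /eqP := chain_zero_ev zb rf; rewrite ev_chain_sub subr_eq0 => /eqP.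
by rewrite zE ev_bd.
Qed.

Theorem theorem2 (K : fieldType) (d m : nat) (A : 'I_m -> rset d) :
  leq 1 d -> leq d.+2 m ->
  (forall i, polyhedron (A i)) ->
  (forall (n : nat) (S : {set 'I_m}), leq 1 n && leq n d.+1 -> #|S| = n ->
      Hred_zero K (bigcapS A S) (GRing.add (Posz d) (GRing.opp (Posz n)))) ->
  exists x : pt d, forall i, A i x.
Proof.
move=> d0 dm polyA HA.
have /choice[Gi hGi] := fun i => polyhedron_halfspaces (polyA i).
pose G := List.flat_map Gi (enum 'I_m).
pose g0 : pt d * R := (fun=> 0%R, 0%R).
pose I : finType := ('I_(size G) * bool)%type.
pose h (i : I) : pt d * R := let g := nth g0 G i.1 in
  if i.2 then g else (fun j => - g.1 j, - g.2)%R.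
have hE k b x : hval (h (k, b)) x =
    if b then hval (nth g0 G k) x else - hval (nth g0 G k) x.
  case: b => //; rewrite /h /hval /= opprD -sumrN.
  by congr (_ + _); apply: eq_bigr => j _; rewrite mulNr.
have h_opp i : exists i', forall x, hval (h i') x = - hval (h i) x.
  case: i => k b; exists (k, ~~ b) => x.
  by rewrite !hE; case: b => //=; rewrite opprK.
have clA i : cell_closed h (A i).
  move=> x y Ax yx; apply: (hGi i) Ax => g gi.
  have : List.In g G.
    apply/List.in_flat_map; exists i; split=> //.
    have : i \in enum 'I_m by rewrite mem_enum.
    elim: (enum _) => //= a l IH; rewrite in_cons.
    by move=> /predU1P[->|/IH]; [left|right].
  move=> /(List.In_nth _ _ g0)[k [/ssrnat.ltP kG <-]].
  have -> : List.nth k G g0 = nth g0 G k by elim: (G) (k) => [|? ? IH] [|?] /=.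
  (* The index [(k, false)] carries the negated form: not positive at [x], it is not positive at
     [y]. *)
  have := subsetP yx (Ordinal kG, false); rewrite !inE !hE /= !oppr_gt0 => sub.
  by rewrite !leNgt; apply: contra.
have clS S : cell_closed h (bigcapS A S).
  by move=> x y Ax yx i iS; apply: clA yx; apply: Ax.
pose X0 := flags_in h (fun _ : pt d => True).
have capE S s : flags_in h (bigcapS A S) s = capX X0 (fun i => flags_in h (A i)) S s.
  rewrite /capX /X0 /flags_in; case: (flag h s) => //=.
  have -> /= : cells_in h (fun _ => True) s by apply/allP => c _; apply/asboolP.
  apply/allP/forallP => [sA i|sA c cs].
    apply/implyP => iS; apply/allP => c /sA /asboolP Ac.
    by apply/asboolP; apply: Ac.
  apply/asboolP => i iS; have /implyP/(_ iS)/allP/(_ c cs) := sA i.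
  by move/asboolP.
have acyc : acyclic K 0 (capX X0 (fun i => flags_in h (A i)) setT).
  apply: (@capX_acyclic K _ m d).
  - exact: flags_in_complex.
  - by move=> i; apply: flags_in_complex.
  - move=> S N Sd NS; apply: (eq_acyclic (X := flags_in h (bigcapS A S))) => [s|].
      exact: capE.
    apply: singular_acyclic_flags => //.
    have := HA _ S Sd erefl.
    by rewrite (_ : (Posz d - Posz #|S|)%R = (Posz N - 1)%R) //; lia.
  - move=> Y N; exact: (high_acyclic h_opp).
  - by rewrite cardsT card_ord; lia.
  - by rewrite cardsT card_ord; lia.
have [|c] := acyclic0_neq0 acyc.
  rewrite -capE; exact: (flags_in_complex h _).1.
rewrite -capE /flags_in => /andP[_]; rewrite /cells_in /= andbT => /asboolP Ac.
by exists (cell_pt h c) => i; apply: Ac.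
Qed.
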